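(* Let $\Gamma$ be a finite connected network and let $h:\Gamma\to\mathbb{R}$ be continuous with $\int_\Gamma h\,dx<0$ and $c(h)>-\infty$. Then the Kazdan-Warner problem with $c=c(h)$, $$\begin{cases}\partial^2 u=c(h)-he^u & \text{on } e_j,\ j\in J,\\ u_j(v_i)=u_k(v_i) & j,k\in Inc_i,\ v_i\in V,\\ \sum_{j\in Inc_i}\partial_j u(v_i)=0 & v_i\in V,\end{cases}$$ admits a solution.
   Context: Network: $\Gamma=(V,E)$ consists of a finite collection of points (vertices) $V=\{v_i\}_{i\in I}\subset\mathbb{R}^n$ connected by a finite collection of continuous non-self-intersecting edges $E=\{e_j\}_{j\in J}$ ($J\neq\emptyset$), where any two edges can intersect only at a vertex. Each edge is parametrized by a continuous injective map $\pi_j:[0,l_j]\to\mathbb{R}^n$, $l_j>0$, whose endpoints $\pi_j(0),\pi_j(l_j)$ are vertices, with $e_j=\pi_j((0,l_j))$ containing no vertex. $\Gamma$ is assumed connected. $Inc_i=\{j\in J: e_j\text{ is incident to }v_i\}$. For $u:\Gamma\to\mathbb{R}$, $u_j:[0,l_j]\to\mathbb{R}$ denotes the restriction of $u$ to edge $j$ in the coordinate $y=\pi_j^{-1}(x)$, and $u_j(v_i)$ means $u_j(\pi_j^{-1}(v_i))$. Derivatives $\partial u,\partial^2u$ on an edge are with respect to the coordinate $y\in(0,l_j)$. At a vertex $v_i$ and $j\in Inc_i$, the oriented derivative is $\partial_j u(v_i)=\lim_{x\in e_j,\,x\to v_i}\frac{u_j(\pi_j^{-1}(x))-u_j(\pi_j^{-1}(v_i))}{|\pi_j^{-1}(x)-\pi_j^{-1}(v_i)|}$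 (derivative pointing from the vertex into the edge). $\int_\Gamma\phi\,dx=\sum_{j\in J}\int_0^{l_j}\phi_j(r)\,dr$. $u$ is continuous on $\Gamma$ if each $u_j\in C([0,l_j])$ and $u_j(v_i)=u_k(v_i)$ for all $i\in I$, $j,k\in Inc_i$. $C^2(\Gamma)$ is the space of continuous functions on $\Gamma$ with $u_j\in C^2([0,l_j])$ for every $j$. For a constant $c\in\mathbb{R}$, a solution of the problem with constant $c$, namely $\partial^2u=c-he^u$ on $e_j$ for all $j\in J$, $u_j(v_i)=u_k(v_i)$ for all $j,k\in Inc_i$, $v_i\in V$, and $\sum_{j\in Inc_i}\partial_ju(v_i)=0$ for all $v_i\in V$, is a function $u\in C^2(\Gamma)$ satisfying these three conditions pointwise (strong solution). Definition of $c(h)$: for $\int_\Gamma h\,dx<0$, $c(h)\in[-\infty,0)$ denotes the constant such that the problem $\partial^2u=c-he^u$ on each $e_j$, with $u$ continuous at the vertices and $\sum_{j\in Inc_i}\partial_ju(v_i)=0$ at every $v_i\in V$, has a solution for every $c$ with $c(h)<c<0$ and no solution for every $c<c(h)$ (such a constant exists and is unique). *)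

(* Defs.v *)
From HB Require Import structures.
From mathcomp Require Import all_boot all_order all_algebra.
From mathcomp Require Import all_classical all_reals all_analysis.
Import Order.TTheory GRing.Theory Num.Theory.
Import numFieldNormedType.Exports.

Set Implicit Arguments.
Unset Strict Implicit.
Unset Printing Implicit Defensive.

Local Open Scope classical_set_scope.
Local Open Scope ring_scope.

(* [epar j] is the parametrization pi_j; only its values on [0, elen j] matter.
   Injectivity of pi_j on the closed interval excludes loops, so the two
   endpoints of an edge are distinct vertices; parallel edges are allowed. *)
Record network_data (R : realType) (n : nat) (I J : finType) := NetworkData {
  vertex : I -> 'rV[R]_n;
  elen : J -> R;
  epar : J -> R -> 'rV[R]_n
}.

Section Network.
Context {R : realType} {n : nat} {I J : finType}.
Variable G : network_data R n I J.

Definition open_edge (j : J) : set 'rV[R]_n := epar G j @` `]0, elen G j[.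

Definition network_set : set 'rV[R]_n :=
  range (vertex G) `|` \bigcup_(j in [set: J]) open_edge j.

Record is_network : Prop := IsNetwork {
  edges_nonempty : (0 < #|J|)%N;
  vertex_inj : injective (vertex G);
  elen_gt0 : forall j, 0 < elen G j;
  epar_continuous : forall j, {within `[0, elen G j], continuous (epar G j)};
  epar_inj : forall j, {in `[0, elen G j] &, injective (epar G j)};
  epar_start : forall j, range (vertex G) (epar G j 0);
  epar_end : forall j, range (vertex G) (epar G j (elen G j));
  vertex_notin_edge : forall i j, ~ open_edge j (vertex G i);
  edges_disjoint : forall j k, j != k -> open_edge j `&` open_edge k = set0;
  network_connected : connected network_set
}.

Definition Inc (i : I) : pred J :=
  [pred j | (epar G j 0 == vertex G i)
         || (epar G j (elen G j) == vertex G i)].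

(* pi_j^{-1}; meaningful on the closed edge pi_j([0, l_j]) only. *)
Definition ecoord (j : J) : 'rV[R]_n -> R :=
  'pinv_(fun=> 0) `[0, elen G j] (epar G j).

(* Functions on the network are represented by total functions on R^n; every
   notion below depends only on the values on [network_set]. *)
Implicit Types u h phi : 'rV[R]_n -> R.

Definition on_edge u (j : J) : R -> R := fun y => u (epar G j y).

(* The conditions u_j(v_i) = u_k(v_i).  As for any u : Gamma -> R, they hold
   automatically here, u_j(v_i) being u(pi_j(pi_j^{-1}(v_i))). *)
Definition vertex_matching u : Prop :=
  forall i j k, j \in Inc i -> k \in Inc i ->
    on_edge u j (ecoord j (vertex G i)) = on_edge u k (ecoord k (vertex G i)).

Definition network_continuous u : Prop :=
  (forall j, {within `[0, elen G j], continuous (on_edge u j)}) /\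
  vertex_matching u.

(* f in C^2([a, b]): f is continuous on [a, b], twice differentiable on (a, b),
   and f', f'' extend continuously to [a, b], by g1 and g2. *)
Definition C2_segment (a b : R) (f : R -> R) : Prop :=
  {within `[a, b], continuous f} /\
  exists g1 g2 : R -> R,
    [/\ {within `[a, b], continuous g1},
        {within `[a, b], continuous g2},
        forall y : R, y \in `]a, b[ -> is_derive y 1 f (g1 y) &
        forall y : R, y \in `]a, b[ -> is_derive y 1 g1 (g2 y)].

Definition network_C2 u : Prop :=
  network_continuous u /\
  forall j, C2_segment 0 (elen G j) (on_edge u j).

Definition oriented_derivative u (j : J) (i : I) : R :=
  lim ((fun x => (on_edge u j (ecoord j x) - on_edge u j (ecoord j (vertex G i)))
                 / `|ecoord j x - ecoord j (vertex G i)|)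
         @ within (open_edge j) (nbhs (vertex G i))).

Definition network_integral phi : R :=
  \sum_(j : J)
    \int[@lebesgue_measure R]_(r in `[0, elen G j]) on_edge phi j r.

Record KW_solution h (c : R) u : Prop := KWSolution {
  KW_C2 : network_C2 u;
  KW_equation : forall j (y : R), y \in `]0, elen G j[ ->
    ((on_edge u j)^`(2))%classic y = c - on_edge h j y * expR (on_edge u j y);
  KW_matching : vertex_matching u;
  KW_kirchhoff : forall i, \sum_(j in Inc i) oriented_derivative u j i = 0
}.

Definition KW_solvable h (c : R) : Prop := exists u, KW_solution h c u.

(* [is_critical_constant h ch] says that ch = c(h), in [-oo, 0). *)
Record is_critical_constant h (ch : \bar R) : Prop := IsCriticalConstant {
  critical_lt0 : (ch < 0)%E;
  critical_above : forall c : R,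
    (ch < c%:E)%E -> c < 0 -> KW_solvable h c;
  critical_below : forall c : R,
    (c%:E < ch)%E -> ~ KW_solvable h c
}.

Lemma critical_constant_unique h (a b : \bar R) :
  is_critical_constant h a -> is_critical_constant h b -> a = b.
Proof.
suff H (x y : \bar R) : is_critical_constant h x -> is_critical_constant h y ->
    ~~ (x < y)%E.
  by move=> ha hb; apply/eqP; rewrite eq_le !leNgt !H.
move=> hx hy; apply/negP => xy.
have [r /andP[xr ry]] : exists r : R, (x < r%:E < y)%E.
  move: (critical_lt0 hy) xy; case: y {hy} => [y| |] //; case: x {hx} => [x| |] //.
    by move=> _; rewrite lte_fin => xy; exists ((x + y) / 2);
      rewrite !lte_fin !midf_lt.
  by move=> _ _; exists (y - 1); rewrite ltNyr lte_fin ltrBlDr ltrDl ltr01.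
apply: (critical_below hy ry); apply: (critical_above hx xr).
by rewrite -lte_fin (lt_trans ry)// (critical_lt0 hy).
Qed.

End Network.

(* Main.v *)
Require Import Defs.
From HB Require Import structures.
From mathcomp Require Import all_boot all_order all_algebra.
From mathcomp Require Import all_classical all_reals all_analysis.
From mathcomp Require Import measurable_realfun.
From mathcomp Require Import ring lra.
Import Order.TTheory GRing.Theory Num.Theory.
Import numFieldNormedType.Exports.

(** Why the problem is solvable at the critical constant [c* = c(h)].

    Let [u] solve the problem with constant [c < 0] and let [u1 >= u] solve it
    with a smaller constant [c1 < c].  Put [w = 1 + delta - exp (u - u1)].  The
    convexity of the exponential gives [- w'' >= h exp(u) w] for small
    [delta > 0], and [w] satisfies the Kirchhoff conditions.  A positive
    function with this property makes [u] stable: for every test function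
    [phi], the integral of [phi'^2 - h exp(u) phi^2] is nonnegative.  The choice
    [phi = exp (alpha u)], with [0 < alpha < 2], turns stability into
    [(2 alpha - alpha^2) int u'^2 phi^2 <= |c| int phi^2].  The constant that
    bounds the Dirichlet energy of [phi] is [alpha |c| / (2 - alpha)], which is
    small with [alpha].  Hence for small [alpha] the minimum of [phi] is at
    least half its maximum, and [max u - min u <= ln 2 / alpha].  Since
    [h = c exp(-u) - u'^2 exp(-u) - (u' exp(-u))'] has a prescribed negative
    integral, [u] is then bounded above and below, uniformly for [c] in
    [(c*, c*/2]] (lemma [sol_apriori]).  No integral is needed in this part:
    [sol_stability] produces a function [Phi] whose increments over the edges
    add up to zero by Kirchhoff's law and whose derivative carries the estimate,
    and the rest follows from the mean value theorem.

    Solutions are produced by monotone iteration.  For [k > 0] the operator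
    [- d^2/dy^2 + k^2] with Kirchhoff conditions is inverted by an explicit
    order-preserving formula: on each edge, the hyperbolic sine kernel applied
    to the right-hand side together with the values at the two endpoints; at a
    vertex, a weighted average coming from Kirchhoff's law.  Solutions of the
    problem are the fixed points of the map that applies this formula to
    [k^2 u + h exp(u) - c].  For large [k] the map is monotone on functions
    bounded by a given constant, and it increases any sufficiently negative
    constant [- M].  The iterates that start at [- M] therefore increase, and
    as soon as they are bounded above they converge to a solution, by dominated
    convergence ([iter_limit]).

    The iteration is used twice.  Below a solution [u1] for [c1 < c] it gives a
    solution [u <= u1] for [c] ([sol_below]), to which the a priori bound [B]
    applies.  With one [k] and one [M] adapted to [B], the iterates for any [c]
    in [(c*, c*/2]] stay below [B]; each iterate depends continuously on [c],
    so the iterates for [c*] itself stay below [B] and converge to a solution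
    ([critical_solution]).

    These arguments live on an abstract metric graph: edges are intervals
    [[0, l j]] from the vertex [s j] to the vertex [t j].  The last part
    translates the embedded network to this setting.  Oriented derivatives are
    one-sided derivatives at the ends of the edges, because the inverse of each
    parametrization is continuous, and topological connectedness of the network
    implies that of the graph. *)

Set Implicit Arguments.
Unset Strict Implicit.
Unset Printing Implicit Defensive.

Local Open Scope classical_set_scope.
Local Open Scope ring_scope.

(** * Differentiable functions on a segment *)

Section D1on.
Context {R : realType}.
Implicit Types (a b x y c : R) (f g df dg : R -> R).

(** [f] is continuous on the segment [[a, b]] and has derivative [df] on its
    interior. *)
Definition D1on (a b : R) (f df : R -> R) : Prop :=
  {within `[a, b], continuous f} /\
  forall y : R, y \in `]a, b[ -> is_derive y 1 f (df y).

Lemma D1on_cont a b f df : D1on a b f df -> {within `[a, b], continuous f}.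
Proof. by case. Qed.

Lemma D1on_eq a b f g df dg : (forall y : R, y \in `]a, b[ -> df y = dg y) ->
  f =1 g -> D1on a b f df -> D1on a b g dg.
Proof.
move=> e /funext -> [cf df']; split => // y yab.
by rewrite -e //; exact: df'.
Qed.

Lemma D1on_sub a b c d f df : a <= c -> d <= b ->
  D1on a b f df -> D1on c d f df.
Proof.
move=> ac db [cf df']; split.
  by apply: continuous_subspaceW cf; apply: subset_itv; rewrite bnd_simp.
move=> y; rewrite in_itv/= => /andP[cy yd]; apply: df'.
by rewrite in_itv/= (le_lt_trans ac cy) (lt_le_trans yd db).
Qed.

Lemma within_continuousM a b f g : {within `[a, b], continuous f} ->
  {within `[a, b], continuous g} ->
  {within `[a, b], continuous (fun y => f y * g y)}.
Proof. by move=> cf cg x; apply: continuousM; [exact: cf|exact: cg]. Qed.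

Lemma within_continuousD a b f g : {within `[a, b], continuous f} ->
  {within `[a, b], continuous g} ->
  {within `[a, b], continuous (fun y => f y + g y)}.
Proof. by move=> cf cg x; apply: continuousD; [exact: cf|exact: cg]. Qed.

Lemma within_continuousN a b f : {within `[a, b], continuous f} ->
  {within `[a, b], continuous (fun y => - f y)}.
Proof. by move=> cf x; apply: continuousN; exact: cf. Qed.

Lemma within_continuous_cst a b c : {within `[a, b], continuous (fun _ : R => c)}.
Proof. by move=> x; exact: cst_continuous. Qed.

Lemma within_continuous_expR a b f : {within `[a, b], continuous f} ->
  {within `[a, b], continuous (fun y => expR (f y))}.
Proof.
move=> cf; apply/subspace_continuousP => x xab.
apply: continuous_cvg; first exact: continuous_expR.
by move/subspace_continuousP: cf; exact.
Qed.

Lemma D1on_cst a b c : D1on a b (fun=> c) (fun=> 0).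
Proof.
split; first by move=> x; exact: cst_continuous.
by move=> y _; exact: is_derive_cst.
Qed.

Lemma D1on_id a b : D1on a b id (fun=> 1).
Proof.
split; last by move=> y _; exact: is_derive_id.
by apply: continuous_subspaceT => x; exact: cvg_id.
Qed.

Lemma D1onD a b f df g dg : D1on a b f df -> D1on a b g dg ->
  D1on a b (fun y => f y + g y) (fun y => df y + dg y).
Proof.
move=> [cf f'] [cg g']; split; first exact: within_continuousD.
by move=> y yab; apply: is_deriveD; [exact: f'|exact: g'].
Qed.

Lemma D1onN a b f df : D1on a b f df ->
  D1on a b (fun y => - f y) (fun y => - df y).
Proof.
move=> [cf f']; split; first exact: within_continuousN.
by move=> y yab; apply: is_deriveN; exact: f'.
Qed.

Lemma D1onB a b f df g dg : D1on a b f df -> D1on a b g dg ->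
  D1on a b (fun y => f y - g y) (fun y => df y - dg y).
Proof. by move=> hf hg; apply: D1onD => //; exact: D1onN. Qed.

Lemma D1onM a b f df g dg : D1on a b f df -> D1on a b g dg ->
  D1on a b (fun y => f y * g y) (fun y => df y * g y + f y * dg y).
Proof.
move=> [cf f'] [cg g']; split; first exact: within_continuousM.
move=> y yab; have := is_deriveM (f' _ yab) (g' _ yab).
by rewrite /GRing.scale/= => h; rewrite addrC [df y * _]mulrC; exact: h.
Qed.

Lemma D1onZ a b f df c : D1on a b f df ->
  D1on a b (fun y => c * f y) (fun y => c * df y).
Proof.
move=> hf; apply: D1on_eq (D1onM (D1on_cst a b c) hf) => // y _.
by rewrite mul0r add0r.
Qed.

Lemma D1on_exp a b f df : D1on a b f df ->
  D1on a b (fun y => expR (f y)) (fun y => df y * expR (f y)).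
Proof.
move=> [cf f']; split; first exact: within_continuous_expR.
move=> y yab; rewrite mulrC; have h1 := f' _ yab.
by have := @is_derive1_comp _ expR f y _ _ (is_derive_expR (f y)) h1.
Qed.

Lemma D1onV a b f df : (forall y : R, y \in `[a, b] -> f y != 0) ->
  D1on a b f df ->
  D1on a b (fun y => (f y)^-1) (fun y => - (df y / f y ^+ 2)).
Proof.
move=> f0 [cf f']; split.
  apply/subspace_continuousP => x xab.
  by apply: cvgV; [exact: f0|move/subspace_continuousP: cf; exact].
move=> y yab; have h1 := f' _ yab.
have fy0 : f y != 0.
  by apply: f0; move: yab; apply: subset_itvW.
have := is_deriveV fy0 h1.
rewrite /GRing.scale/= => h; apply: is_derive_eq h _.
by rewrite mulNr mulrC.
Qed.


Lemma within_continuous_bounded a b f : {within `[a, b], continuous f} ->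
  exists2 M : R, 0 < M & forall y : R, y \in `[a, b] -> `|f y| <= M.
Proof.
move=> cf; have [M [Mr hM]] := compact_bounded (continuous_compact cf (@segment_compact _ a b)).
exists (`|M| + 1); first by rewrite ltr_wpDl.
move=> y yab; apply: (hM (`|M| + 1)); first by rewrite ltr_pwDr// ler_norm.
by exists y.
Qed.

(** The only form in which the mean value theorem is used for the a priori
    bounds. *)
Lemma D1on_le_slope a b f df k : a <= b -> D1on a b f df ->
  (forall y : R, y \in `]a, b[ -> df y <= k) -> f b - f a <= k * (b - a).
Proof.
rewrite le_eqVlt => /predU1P[->|ab] [cf f'] h; first by rewrite !subrr mulr0.
have [y yab ->] := MVT ab f' cf.
by rewrite ler_pM2r ?subr_gt0// h.
Qed.

Lemma ftc2 a b F f : a <= b -> {within `[a, b], continuous f} ->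
  D1on a b F f -> \int[@lebesgue_measure R]_(x in `[a, b]) f x = F b - F a.
Proof.
rewrite le_eqVlt => /predU1P[->|ab] cf [cF F'].
  by rewrite set_itv1 subrr /Rintegral integral_set1.
rewrite /Rintegral (@continuous_FTC2 _ f F)//.
- have [_ r lft] := (continuous_within_itvP F ab).1 cF.
  by split => // y yab; have := F' y yab => -[].
- by move=> y yab; have [_ e] := F' y yab; rewrite derive1E.
Qed.

End D1on.

(** * Differential inequalities and a priori bounds on a metric graph *)

Section Graph.
Context {R : realType} {I J : finType}.
Variables (s t : J -> I) (l : J -> R).
Hypothesis l_gt0 : forall j, 0 < l j.

Lemma family_bounded (f : J -> R -> R) :
  (forall j, {within `[0, l j], continuous (f j)}) ->
  exists2 M : R, 0 < M & forall j (y : R), y \in `[0, l j] -> `|f j y| <= M.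
Proof.
move=> cf.
have H j : exists M : R, 0 < M /\ forall y : R, y \in `[0, l j] -> `|f j y| <= M.
  by have [M M0 hM] := within_continuous_bounded (cf j); exists M.
have [Mf hMf] := choice H.
exists (1 + \sum_j Mf j).
  by rewrite ltr_pwDl// sumr_ge0// => j _; have [/ltW] := hMf j.
move=> j y yj; apply: (le_trans ((hMf j).2 _ yj)).
rewrite (bigD1 j)//= addrCA lerDl addr_ge0// sumr_ge0// => i _.
by have [/ltW] := hMf i.
Qed.

Lemma family_max (f : J -> R -> R) (j0 : J) :
  (forall j, {within `[0, l j], continuous (f j)}) ->
  exists j1 (y1 : R), y1 \in `[0, l j1] /\
    forall j (y : R), y \in `[0, l j] -> f j y <= f j1 y1.
Proof.
move=> cf.
have H j : exists c : R, c \in `[0, l j] /\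
    forall y : R, y \in `[0, l j] -> f j y <= f j c.
  by have [c] := EVT_max (ltW (l_gt0 j)) (cf j); exists c.
have [c hc] := choice H.
pose j1 := [arg max_(j > j0) f j (c j)]%O.
have hj1 j : f j (c j) <= f j1 (c j1).
  by rewrite /j1; case: arg_maxP => // i _; exact.
exists j1, (c j1); split; first by have [] := hc j1.
by move=> j y yj; apply: le_trans (hj1 j); exact: (hc j).2.
Qed.

(** A twice differentiable function on the metric graph, given by its vertex
    values [a], its restrictions [U] to the edges, and the first and second
    derivatives [g] and [d] of these.  The last clause is Kirchhoff's law at
    [i]: edges leaving [i] contribute [g j 0] and edges arriving at [i]
    contribute [- g j (l j)]. *)
Definition netC2 (a : I -> R) (U g d : J -> R -> R) : Prop :=
  [/\ forall j, U j 0 = a (s j), forall j, U j (l j) = a (t j),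
      forall j, D1on 0 (l j) (U j) (g j), forall j, D1on 0 (l j) (g j) (d j) &
      forall i, \sum_(j | s j == i) g j 0 = \sum_(j | t j == i) g j (l j)].

(** Kirchhoff's law in summed form: for any vertex function [F], the boundary
    terms of [F g] over all the edges cancel. *)
Lemma kirchhoff_sum (F a : I -> R) (U g d : J -> R -> R) : netC2 a U g d ->
  \sum_j (F (t j) * g j (l j) - F (s j) * g j 0) = 0.
Proof.
move=> [_ _ _ _ K]; rewrite sumrB.
rewrite (partition_big t predT)//= [X in _ - X](partition_big s predT)//=.
rewrite -sumrB big1// => i _.
rewrite (eq_bigr (fun j => F i * g j (l j))); last by move=> j /eqP ->.
rewrite [X in _ - X](eq_bigr (fun j => F i * g j 0)); last by move=> j /eqP ->.
by rewrite -!mulr_sumr K subrr.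
Qed.

Variable h : J -> R -> R.
Hypothesis ch : forall j, {within `[0, l j], continuous (h j)}.

(** Solutions of the problem with constant [c] on the metric graph. *)
Definition sol (c : R) (a : I -> R) (U g : J -> R -> R) : Prop :=
  netC2 a U g (fun j y => c - h j y * expR (U j y)).

(** A solution [u] for [c] that lies below a solution [u1] for some [c1 < c] is
    stable, stated as a differential inequality.  With
    [w = 1 + delta - exp (u - u1) > 0], the function is
    [Phi = exp (2 alpha u) (w' / w - u')]: the term [w' / w] comes from testing
    [- w'' >= h exp(u) w] with [exp (2 alpha u) / w], the term [u'] from testing
    the equation of [u] with [exp (2 alpha u)]. *)
Lemma sol_stability (c c1 alpha : R) a u g a1 u1 g1 :
  sol c a u g -> sol c1 a1 u1 g1 -> c1 < c ->
  (forall j (y : R), y \in `[0, l j] -> u j y <= u1 j y) ->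
  exists Phi dPhi : J -> R -> R,
  [/\ forall j, D1on 0 (l j) (Phi j) (dPhi j),
      forall j (y : R), y \in `]0, l j[ -> dPhi j y <=
        expR (2 * alpha * u j y) * ((alpha ^+ 2 - 2 * alpha) * g j y ^+ 2 - c) &
      \sum_j (Phi j (l j) - Phi j 0) = 0].
Proof.
move=> S S1 c1c uu1.
have [u0 ul Du Dg K] := S; have [u10 u1l Du1 Dg1 K1] := S1.
(* [delta] is chosen such that [delta h exp(u1) <= c - c1] on all edges. *)
have [Q Q0 hQ] : exists2 Q : R, 0 < Q &
    forall j (y : R), y \in `[0, l j] -> `|h j y * expR (u1 j y)| <= Q.
  apply: family_bounded => j; apply: within_continuousM; first exact: ch.
  exact: (D1on_cont (D1on_exp (Du1 j))).
pose delta := (c - c1) / Q.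
have delta0 : 0 < delta by rewrite divr_gt0// subr_gt0.
have hdelta j (y : R) : y \in `[0, l j] ->
    delta * (h j y * expR (u1 j y)) <= c - c1.
  move=> yj; have := hQ j y yj; rewrite ler_norml => /andP[_ q].
  by rewrite /delta mulrAC ler_pdivrMr// ler_pM2l// subr_gt0.
pose E j y := expR (2 * alpha * u j y).
pose Z j y := expR (u j y - u1 j y).
pose w j y := 1 + delta - Z j y.
pose W j y := - (Z j y * (g j y - g1 j y)).
have w_gt0 j (y : R) : y \in `[0, l j] -> 0 < w j y.
  move=> /uu1 uu; have : Z j y <= 1 by rewrite -expR0 ler_expR subr_le0.
  by rewrite /w; lra.
pose d j y := c - h j y * expR (u j y).
pose d1 j y := c1 - h j y * expR (u1 j y).
pose dE j y := 2 * alpha * g j y * E j y.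
pose dZ j y := (g j y - g1 j y) * Z j y.
pose dw j y := 0 - dZ j y.
pose dW j y := - (dZ j y * (g j y - g1 j y) + Z j y * (d j y - d1 j y)).
have DE j : D1on 0 (l j) (E j) (dE j) by apply: D1on_exp; exact: D1onZ.
have DZ j : D1on 0 (l j) (Z j) (dZ j) by apply: D1on_exp; exact: D1onB.
have Dw j : D1on 0 (l j) (w j) (dw j) by apply: D1onB => //; exact: D1on_cst.
have DW j : D1on 0 (l j) (W j) (dW j).
  by apply: D1onN; apply: D1onM => //; exact: D1onB.
pose Phi j y := E j y * (W j y * (w j y)^-1 - g j y).
have DPhi j := D1onM (DE j) (D1onB (D1onM (DW j) (D1onV
  (fun y yj => lt0r_neq0 (w_gt0 j y yj)) (Dw j))) (Dg j)).
exists Phi; eexists; split; first by move=> j; exact: DPhi.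
- move=> j y yj; have yj' : y \in `[0, l j] by apply: subset_itvW yj.
  have wy := w_gt0 _ _ yj'.
  have XZ : expR (u j y) = Z j y * expR (u1 j y).
    by rewrite -expRD subrK.
  set r := W j y / w j y.
  set p := g j y - g1 j y.
  (* [w'' + h exp(u) w = - q], and the inequality [q >= 0] is the supersolution
property of [w]. *)
  pose q := Z j y * (p ^+ 2 + (c - c1 - delta * (h j y * expR (u1 j y)))).
  have q0 : 0 <= q / w j y.
    rewrite divr_ge0 ?(ltW wy)// /q mulr_ge0 ?expR_ge0// addr_ge0 ?sqr_ge0//.
    by rewrite subr_ge0 hdelta.
  rewrite [leLHS](_ : _ = E j y * (2 * alpha * g j y * r -
      2 * alpha * g j y ^+ 2 - r ^+ 2 - c - q / w j y)).
    rewrite ler_pM2l ?expR_gt0//.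
    (* [2 alpha u' r - r^2 <= alpha^2 u'^2], where [r = w' / w]. *)
    have : 0 <= (alpha * g j y - r) ^+ 2 by rewrite sqr_ge0.
    move: q0; set qq := q / _; nra.
  rewrite /r /dE /dW /dw /W /dZ /d /d1 -/p /q XZ.
  have : w j y != 0 by rewrite gt_eqF.
  rewrite /w; set z := Z j y; set X := expR (u1 j y) => w0.
  by field.
(* [Phi] is [F1 u1' - F u'], with vertex functions [F] and [F1]. *)
- pose F i := expR (2 * alpha * a i) *
    (expR (a i - a1 i) / (1 + delta - expR (a i - a1 i)) + 1).
  pose F1 i := expR (2 * alpha * a i) *
    (expR (a i - a1 i) / (1 + delta - expR (a i - a1 i))).
  have k := kirchhoff_sum F S; have k1 := kirchhoff_sum F1 S1.
  transitivity ((0 : R) - 0); last exact: subr0.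
  rewrite -[X in X - _]k1 -[X in _ - X]k -sumrB; apply: eq_bigr => j _.
  rewrite /Phi /E /W /w /Z u0 ul u10 u1l /F /F1.
  ring.
Qed.


Definition total_length : R := \sum_j l j.

Lemma sum_slopes (F dF : J -> R -> R) (k : R) :
  (forall j, D1on 0 (l j) (F j) (dF j)) ->
  (forall j (y : R), y \in `]0, l j[ -> dF j y <= k) ->
  \sum_j (F j (l j) - F j 0) <= k * total_length.
Proof.
move=> DF dFk; rewrite mulr_sumr; apply: ler_sum => j _.
have := D1on_le_slope (ltW (l_gt0 j)) (DF j) (dFk j).
by rewrite subr0.
Qed.

(** If the derivatives of the [F j] are at most [k] and the increments of [F]
    over all the edges add up to zero, then [F] cannot decrease by more than [k]
    times the total length on any piece of an edge, since it must make up for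
    the decrease elsewhere. *)
Lemma balanced_decrement (F dF : J -> R -> R) (k : R) : 0 <= k ->
  (forall j, D1on 0 (l j) (F j) (dF j)) ->
  (forall j (y : R), y \in `]0, l j[ -> dF j y <= k) ->
  \sum_j (F j (l j) - F j 0) = 0 ->
  forall j (x y : R), 0 <= x -> x <= y -> y <= l j ->
    F j x - F j y <= k * total_length.
Proof.
move=> k0 DF dFk F0 j x y x0 xy yl.
have h1 : F j x - F j 0 <= k * (x - 0).
  apply: (@D1on_le_slope _ _ _ _ (dF j)) => //.
    by apply: D1on_sub (DF j) => //; exact: le_trans yl.
  move=> z; rewrite in_itv/= => /andP[z0 zx]; apply: dFk.
  by rewrite in_itv/= z0 (lt_le_trans zx)// (le_trans xy).
have h2 : F j (l j) - F j y <= k * (l j - y).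
  apply: (@D1on_le_slope _ _ _ _ (dF j)) => //.
    by apply: D1on_sub (DF j) => //; exact: le_trans xy.
  move=> z; rewrite in_itv/= => /andP[z0 zx]; apply: dFk.
  by rewrite in_itv/= zx (le_lt_trans _ z0)// (le_trans x0).
have h3 : \sum_(i | i != j) (F i (l i) - F i 0) <= \sum_(i | i != j) k * l i.
  apply: ler_sum => i _.
  by have := D1on_le_slope (ltW (l_gt0 i)) (DF i) (dFk i); rewrite subr0.
move: F0; rewrite (bigD1 j)//= => F0.
rewrite /total_length (bigD1 j)//= mulrDr mulr_sumr.
have h4 : 0 <= k * (y - x) by rewrite mulr_ge0// subr_ge0.
move: h1 h2 h3 F0 h4; set A := \sum_(i | _) _; set B := \sum_(i | _) _; nra.
Qed.

(** Oscillation of [exp (alpha u)] on one edge, relative to its maximum [m].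
    The free parameter [eps] comes from Young's inequality
    [phi' <= phi'^2 / (2 eps m) + eps m / 2]. *)
Lemma sol_edge_osc (c c1 alpha m eps : R) a u g a1 u1 g1 :
  sol c a u g -> sol c1 a1 u1 g1 -> c1 < c -> c < 0 ->
  (forall j (y : R), y \in `[0, l j] -> u j y <= u1 j y) ->
  0 < alpha -> alpha < 2 -> 0 < eps -> 0 < m ->
  (forall j (y : R), y \in `[0, l j] -> expR (alpha * u j y) <= m) ->
  forall j (x y : R), 0 <= x -> x <= y -> y <= l j ->
  `|expR (alpha * u j y) - expR (alpha * u j x)| <=
    m * (alpha * (- c) * total_length / (eps * (2 - alpha)) +
         eps * total_length / 2).
Proof.
move=> S S1 c1c c0 uu1 al0 al2 eps0 m0 um.
have [Phi [dPhi [DPhi dPhi_le sumPhi]]] := sol_stability alpha S S1 c1c uu1.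
have [_ _ Du _ _] := S.
pose k := - c * m ^+ 2.
have k0 : 0 <= k by rewrite mulr_ge0 ?sqr_ge0// oppr_ge0 ltW.
have expE j y : expR (2 * alpha * u j y) = expR (alpha * u j y) ^+ 2.
  by rewrite -mulrA mulrC -expRM_natr.
have dPhik j (y : R) : y \in `]0, l j[ -> dPhi j y <= k -
    (2 * alpha - alpha ^+ 2) * (g j y * expR (alpha * u j y)) ^+ 2.
  move=> yj; apply: (le_trans (dPhi_le j y yj)); rewrite expE /k.
  have yj' : y \in `[0, l j] by apply: subset_itvW yj.
  have := um j y yj'; have := expR_gt0 (alpha * u j y).
  set e := expR _ => e0 em.
  have : e ^+ 2 <= m ^+ 2 by rewrite ler_pXn2r// ?nnegrE ltW.
  rewrite exprMn; move: (e ^+ 2) => e2; nra.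
(* [lam] is the multiple of [Phi] whose term in [phi'^2] completes the
square in [phi' - phi'^2 / (2 eps m) - eps m / 2]. *)
pose lam := alpha / (2 * eps * (2 - alpha) * m).
have al2' : 0 < 2 - alpha by rewrite subr_gt0.
have lam0 : 0 < lam by rewrite divr_gt0// !mulr_gt0.
have key (sg : R) j (x y : R) : sg ^+ 2 = 1 -> 0 <= x -> x <= y -> y <= l j ->
    sg * (expR (alpha * u j y) - expR (alpha * u j x)) <=
    2 * lam * k * total_length + eps * m / 2 * total_length.
  move=> sg2 x0 xy yl.
  pose F z := sg * expR (alpha * u j z) + lam * Phi j z.
  have DF := D1onD (D1onZ sg (D1on_exp (D1onZ alpha (Du j)))) (D1onZ lam (DPhi j)).
  have F_le : F y - F x <= (lam * k + eps * m / 2) * (y - x).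
    apply: (D1on_le_slope xy (D1on_sub x0 yl DF)) => z; rewrite in_itv/= => /andP[xz zy].
    have zl : z \in `]0, l j[ by rewrite in_itv/= (le_lt_trans x0 xz) (lt_le_trans zy yl).
    have := dPhik j z zl.
    rewrite -mulrA; set X := g j z * expR _ => dX.
    have lamE : lam * (2 * alpha - alpha ^+ 2) = alpha ^+ 2 / (2 * eps * m).
      by rewrite /lam; field; rewrite !gt_eqF.
    have : lam * dPhi j z <= lam * k - alpha ^+ 2 / (2 * eps * m) * X ^+ 2.
      by rewrite -lamE -mulrA -mulrBr ler_pM2l.
    have : 0 <= (alpha * X - sg * (eps * m)) ^+ 2 / (2 * eps * m).
      by rewrite divr_ge0 ?sqr_ge0// !mulr_ge0// ltW.
    rewrite [X in 0 <= X -> _](_ : _ = alpha ^+ 2 / (2 * eps * m) * X ^+ 2 +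
        sg ^+ 2 * (eps * m / 2) - sg * (alpha * X)); last by field; rewrite !gt_eqF.
    rewrite sg2; lra.
  have yxL : y - x <= total_length.
    rewrite /total_length (bigD1 j)//=.
    have : 0 <= \sum_(i | i != j) l i by apply: sumr_ge0 => i _; exact/ltW.
    lra.
  have dPhi_k i (z : R) : z \in `]0, l i[ -> dPhi i z <= k.
    move=> zi; apply: (le_trans (dPhik i z zi)).
    rewrite lerBlDr lerDl mulr_ge0 ?sqr_ge0//.
    by rewrite expr2 -mulrBl mulr_ge0// ltW.
  have dec := balanced_decrement k0 DPhi dPhi_k sumPhi x0 xy yl.
  have h1 : (lam * k + eps * m / 2) * (y - x) <= (lam * k + eps * m / 2) * total_length.
    have lk0 : 0 <= lam * k by rewrite mulr_ge0// ltW.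
    have em0 : 0 < eps * m by rewrite mulr_gt0.
    by rewrite ler_wpM2l//; lra.
  have h2 : lam * (Phi j x - Phi j y) <= lam * (k * total_length) by rewrite ler_pM2l.
  move: F_le; rewrite /F; lra.
move=> j x y x0 xy yl.
rewrite [leRHS](_ : _ = 2 * lam * k * total_length + eps * m / 2 * total_length).
  rewrite ler_norml; apply/andP; split.
    by rewrite lerNl -mulN1r; apply: key => //; rewrite sqrrN expr1n.
  by rewrite -[leLHS]mul1r; apply: key => //; rewrite expr1n.
by rewrite /lam /k; field; rewrite !gt_eqF.
Qed.

Hypothesis conn : forall P : I -> Prop, (exists i, P i) ->
  (forall j, P (s j) <-> P (t j)) -> forall i, P i.

(** On a connected graph a vertex function that varies by at most [D] along
    each edge varies by at most [N D] overall, where [N] depends on the graph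
    only. *)
Lemma connected_chain : exists N : nat, forall (a : I -> R) (D : R), 0 <= D ->
  (forall j, `|a (s j) - a (t j)| <= D) ->
  forall i i', `|a i - a i'| <= N%:R * D.
Proof.
have H i' i : exists N : nat, forall (a : I -> R) (D : R), 0 <= D ->
    (forall j, `|a (s j) - a (t j)| <= D) -> `|a i - a i'| <= N%:R * D.
  apply: (conn (P := fun i => exists N : nat, forall (a : I -> R) (D : R), 0 <= D ->
    (forall j, `|a (s j) - a (t j)| <= D) -> `|a i - a i'| <= N%:R * D)).
    by exists i', 0%N => a D _ _; rewrite subrr normr0 mul0r.
  by move=> j; split=> -[N hN]; exists N.+1 => a D D0 aD;
    have := hN a D D0 aD; have := aD j;
    rewrite -natr1 mulrDl mul1r !ler_norml => /andP[? ?] /andP[? ?]; lra.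
have H2 (p : I * I) : exists N : nat, forall (a : I -> R) (D : R), 0 <= D ->
    (forall j, `|a (s j) - a (t j)| <= D) -> `|a p.1 - a p.2| <= N%:R * D.
  exact: H.
have [Nf hNf] := choice H2.
exists (\max_p Nf p)%N => a D D0 aD i i'.
apply: (le_trans (hNf (i, i') a D D0 aD)).
by rewrite ler_wpM2r// ler_nat; exact: leq_bigmax.
Qed.

(** Harnack inequality: the exponent [alpha] depends only on the graph and on
    the bound [cs] for [|c|]. *)
Lemma sol_osc (cs : R) : 0 < cs -> (0 < #|J|)%N ->
  exists alpha : R, [/\ 0 < alpha, alpha < 2 &
  forall (c c1 : R) a u g a1 u1 g1,
  sol c a u g -> sol c1 a1 u1 g1 -> c1 < c -> c < 0 -> - cs <= c ->
  (forall j (y : R), y \in `[0, l j] -> u j y <= u1 j y) ->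
  forall j (y : R) j' (y' : R), y \in `[0, l j] -> y' \in `[0, l j'] ->
    expR (alpha * u j y) <= 2 * expR (alpha * u j' y')].
Proof.
move=> cs0 /card_gt0P[j0 _].
have [N hN] := connected_chain.
have L0 : 0 < total_length.
  rewrite /total_length (bigD1 j0)//= ltr_pwDl// sumr_ge0// => j _; exact/ltW.
pose kap : R := (2 * (N.+2)%:R)^-1.
have kap0 : 0 < kap by rewrite invr_gt0 mulr_gt0.
(* With these values the oscillation of [phi] on an edge is at most [kap m],
and the whole graph is covered by [N + 2] such steps, so that [phi]
oscillates by at most [m / 2]. *)
pose eps := kap / total_length.
have eps0 : 0 < eps by rewrite divr_gt0.
pose al1 := kap ^+ 2 / (2 * cs * total_length ^+ 2).
have al10 : 0 < al1 by rewrite divr_gt0// ?exprn_gt0// !mulr_gt0// exprn_gt0.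
pose alpha := Num.min 1 al1.
have al0 : 0 < alpha by rewrite lt_min ltr01.
have alle1 : alpha <= 1 by rewrite ge_min lexx.
have al2 : alpha < 2 by rewrite (le_lt_trans alle1)// ltr1n.
exists alpha; split => // c c1 a u g a1 u1 g1 S S1 c1c c0 csc uu1.
have [u0 ul Du _ _] := S.
have [jm [ym [ymj umax]]] := family_max j0 (fun j => D1on_cont (Du j)).
pose m := expR (alpha * u jm ym).
have m0 : 0 < m by exact: expR_gt0.
have um j (y : R) : y \in `[0, l j] -> expR (alpha * u j y) <= m.
  by move=> yj; rewrite ler_expR ler_pM2l// umax.
have osc j (x y : R) : 0 <= x -> x <= y -> y <= l j ->
    `|expR (alpha * u j y) - expR (alpha * u j x)| <= m * kap.
  move=> x0 xy yl.
  apply: (le_trans (sol_edge_osc S S1 c1c c0 uu1 al0 al2 eps0 m0 um x0 xy yl)).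
  rewrite ler_pM2l//.
  have h1 : eps * total_length / 2 = kap / 2.
    by rewrite /eps; field; rewrite gt_eqF.
  have h2 : alpha * - c * total_length / (eps * (2 - alpha)) <= kap / 2.
    rewrite ler_pdivrMr; last by rewrite mulr_gt0// subr_gt0.
    have : alpha * - c <= al1 * cs.
      rewrite ler_pM//; [exact/ltW|by rewrite oppr_ge0 ltW| |by rewrite lerNl].
      by rewrite ge_min lexx orbT.
    have e1 : al1 * cs = kap / 2 * eps / total_length.
      by rewrite /al1 /eps; field; rewrite !gt_eqF.
    rewrite e1 => hac.
    have : alpha * - c * total_length <= kap / 2 * eps.
      by rewrite -ler_pdivlMr.
    have : kap / 2 * eps <= kap / 2 * (eps * (2 - alpha)).
      have ke : 0 < kap / 2 * eps by rewrite mulr_gt0 ?divr_gt0.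
      by rewrite mulrA ler_peMr ?(ltW ke)//; lra.
    by move=> h3 h4; exact: le_trans h3.
  rewrite h1; lra.
have mk0 : 0 <= m * kap by rewrite mulr_ge0// ltW.
have vosc := hN (fun i => expR (alpha * a i)) _ mk0 _.
move=> j y j' y' yj yj'.
have pt i (z : R) : z \in `[0, l i] ->
    `|expR (alpha * u i z) - expR (alpha * a (s i))| <= m * kap.
  rewrite in_itv/= => /andP[z0 zl]; rewrite -u0; exact: osc.
have vo : `|expR (alpha * a (s jm)) - expR (alpha * a (s j'))| <= N%:R * (m * kap).
  apply: vosc => i; rewrite -u0 -ul distrC; apply: osc => //; exact/ltW.
have h1 := pt _ _ ymj; have h2 := pt _ _ yj'.
have h3 : (N.+2)%:R * (m * kap) = m / 2.
  have : 0 < N.+2%:R :> R by rewrite ltr0Sn.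
  by rewrite /kap; move: N.+2%:R => K K0; field; rewrite gt_eqF.
have h4 := um _ _ yj.
rewrite -addn2 natrD mulrDl in h3.
move: h3 vo h1 h2; rewrite -/m !ler_norml.
move: h4; set A := expR (alpha * u j y); set B := expR (alpha * u j' y').
set mk := m * kap; set C := N%:R * mk.
move=> ? ? /andP[? ?] /andP[? ?] /andP[? ?]; lra.
Qed.

(** Uniform bound for the solutions that lie below a solution with a smaller
    constant.  The lower bound comes from integrating
    [h <= c exp(-u) - (u' exp(-u))'], the upper bound from integrating
    [h = c exp(-u) - u'^2 exp(-u) - (u' exp(-u))'] after absorbing
    [u'^2 exp(-u)] into [Phi']. *)
Lemma sol_apriori (cs : R) (H : J -> R -> R) : 0 < cs -> (0 < #|J|)%N ->
  (forall j, D1on 0 (l j) (H j) (h j)) ->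
  \sum_j (H j (l j) - H j 0) < 0 ->
  exists B : R, forall (c c1 : R) a u g a1 u1 g1,
  sol c a u g -> sol c1 a1 u1 g1 -> c1 < c -> - cs <= c -> c <= - (cs / 2) ->
  (forall j (y : R), y \in `[0, l j] -> u j y <= u1 j y) ->
  forall j (y : R), y \in `[0, l j] -> `|u j y| <= B.
Proof.
move=> cs0 J0 DH H0; have /card_gt0P[j0 _] := J0.
have [alpha [al0 al2 osc]] := sol_osc cs0 J0.
have L0 : 0 < total_length.
  rewrite /total_length (bigD1 j0)//= ltr_pwDl// sumr_ge0// => j _; exact/ltW.
pose eta := - \sum_j (H j (l j) - H j 0).
have eta0 : 0 < eta by rewrite oppr_gt0.
pose K2 := 2 * alpha - alpha ^+ 2.
have K20 : 0 < K2 by rewrite /K2 expr2 -mulrBl mulr_gt0// subr_gt0.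
pose q1 := 2 * eta / (cs * total_length).
pose q2 := eta / (cs * (1 + 4 / K2) * total_length).
have K2' : 0 < 1 + 4 / K2 by rewrite addr_gt0// divr_gt0.
have q10 : 0 < q1 by rewrite divr_gt0// !mulr_gt0.
have q20 : 0 < q2 by rewrite divr_gt0// !mulr_gt0.
pose om := ln 2 / alpha.
have om0 : 0 <= om by rewrite divr_ge0 ?ltW// ln_gt0// ltr1n.
exists (`|ln q1| + `|ln q2| + om) => c c1 a u g a1 u1 g1 S S1 c1c csc ccs uu1.
have c0 : c < 0 by rewrite (le_lt_trans ccs)// oppr_lt0 divr_gt0.
have [u0 ul Du Dg _] := S.
have oscu j (y : R) j' (y' : R) : y \in `[0, l j] -> y' \in `[0, l j'] ->
    u j y <= u j' y' + om.
  move=> yj yj'; have := osc _ _ _ _ _ _ _ _ S S1 c1c c0 csc uu1 _ _ _ _ yj yj'.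
  rewrite -[X in X * expR _](@lnK R 2) ?posrE// -expRD ler_expR => h1.
  by rewrite -(ler_pM2l al0) mulrDr /om mulrCA divff ?gt_eqF// mulr1 addrC.
have [jm [ym [ymj umax]]] := family_max j0 (fun j => D1on_cont (Du j)).
have [jn [yn [ynj umin]]] := family_max j0 (fun j => D1on_cont (D1onN (Du j))).
have {}umin j (y : R) : y \in `[0, l j] -> u jn yn <= u j y.
  by move=> yj; have := umin j y yj; rewrite lerN2.
have DF j := D1onD (DH j) (D1onM (Dg j) (D1on_exp (D1onN (Du j)))).
have sumF : \sum_j (H j (l j) + g j (l j) * expR (- u j (l j)) -
    (H j 0 + g j 0 * expR (- u j 0))) = - eta.
  have := kirchhoff_sum (fun i => expR (- a i)) S.
  rewrite /eta opprK => k; rewrite -[RHS]addr0 -[X in _ = _ + X]k -big_split/=.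
  by apply: eq_bigr => j _; rewrite u0 ul; ring.
have dFE j y : h j y + ((c - h j y * expR (u j y)) * expR (- u j y) +
    g j y * (- g j y * expR (- u j y))) = (c - g j y ^+ 2) * expR (- u j y).
  rewrite expRN; have : expR (u j y) != 0 by rewrite gt_eqF// expR_gt0.
  by set e := expR _ => e0; field.
have low : expR (- u jm ym) <= q1.
  have F_le j (y : R) : y \in `]0, l j[ -> h j y + ((c - h j y * expR (u j y)) *
      expR (- u j y) + g j y * (- g j y * expR (- u j y))) <= c * expR (- u jm ym).
    move=> yj; have yj' : y \in `[0, l j] by apply: subset_itvW yj.
    rewrite dFE mulrBl lerBlDr ler_wpDr//.
      by rewrite mulr_ge0 ?sqr_ge0 ?expR_ge0.
    have : expR (- u jm ym) <= expR (- u j y) by rewrite ler_expR lerN2 umax.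
    by rewrite ler_nM2l.
  have := sum_slopes DF F_le; rewrite sumF.
  set e := expR _ => h1.
  have e0 : 0 <= e by exact: expR_ge0.
  rewrite /q1 ler_pdivlMr ?mulr_gt0//.
  have X0 : 0 <= e * total_length by rewrite mulr_ge0// ltW.
  have : c * (e * total_length) <= - (cs / 2) * (e * total_length).
    by rewrite ler_wpM2r.
  lra.
have upp : q2 <= expR (- u jn yn).
  have [Phi [dPhi [DPhi dPhi_le sumPhi]]] := sol_stability alpha S S1 c1c uu1.
  set q := expR (- u jn yn); have q_gt0 : 0 < q by exact: expR_gt0.
  pose m := expR (alpha * u jm ym).
  have m0 : 0 < m by exact: expR_gt0.
  have phi_m j (y : R) : y \in `[0, l j] ->
      [/\ expR (- u j y) <= q, expR (alpha * u j y) <= m &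
          m <= 2 * expR (alpha * u j y)].
    move=> yj; split.
    - by rewrite ler_expR lerN2 umin.
    - by rewrite ler_expR ler_pM2l// umax.
    - exact: (osc _ _ _ _ _ _ _ _ S S1 c1c c0 csc uu1 _ _ _ _ ymj yj).
  (* Since [phi^2 >= m^2 / 4], one has
[u'^2 exp(-u) <= (4 q / m^2) u'^2 phi^2], and [kap] is the multiple of [Phi]
that absorbs this term. *)
  pose kap := 4 * q / (m ^+ 2 * K2).
  have m20 : 0 < m ^+ 2 by rewrite exprn_gt0.
  have kap0 : 0 < kap by rewrite divr_gt0// !mulr_gt0.
  have DG j := D1onB (D1onZ kap (DPhi j)) (DF j).
  have G_le j (y : R) : y \in `]0, l j[ -> kap * dPhi j y -
      (h j y + ((c - h j y * expR (u j y)) *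
      expR (- u j y) + g j y * (- g j y * expR (- u j y)))) <=
      - c * q * (1 + 4 / K2).
    move=> yj; have yj' : y \in `[0, l j] by apply: subset_itvW yj.
    rewrite dFE.
    have [] := phi_m j y yj'.
    have := dPhi_le j y yj.
    have -> : expR (2 * alpha * u j y) = expR (alpha * u j y) ^+ 2.
      by rewrite -mulrA mulrC -expRM_natr.
    have := expR_gt0 (alpha * u j y); have := expR_gt0 (- u j y).
    set ph := expR (alpha * _); set e := expR (- _); set dp := dPhi j y.
    set G := g j y => e0 ph0 hdp eq phm mph.
    have ph2 : ph ^+ 2 <= m ^+ 2 by rewrite ler_pXn2r// nnegrE ltW.
    have mph2 : m ^+ 2 <= 4 * ph ^+ 2.
      have : m ^+ 2 <= (2 * ph) ^+ 2.
        by rewrite ler_pXn2r// nnegrE ltW// mulr_gt0.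
      rewrite exprMn; lra.
    have hdp2 : dp <= - K2 * (ph ^+ 2 * G ^+ 2) - c * m ^+ 2.
      apply: (le_trans hdp); rewrite /K2.
      have : - c * ph ^+ 2 <= - c * m ^+ 2 by rewrite ler_pM2l// oppr_gt0.
      lra.
    have kdp : kap * dp <= - (4 * q / m ^+ 2) * (ph ^+ 2 * G ^+ 2) -
        c * (4 * q / K2).
      have : kap * dp <= kap * (- K2 * (ph ^+ 2 * G ^+ 2) - c * m ^+ 2).
        by rewrite ler_pM2l.
      congr (_ <= _); rewrite /kap; field; rewrite !gt_eqF//.
    have ce : - c * e <= - c * q by rewrite ler_pM2l// oppr_gt0.
    have Ge : G ^+ 2 * e <= 4 * q / m ^+ 2 * (ph ^+ 2 * G ^+ 2).
      rewrite [leRHS](_ : _ = (G ^+ 2 * q) * (4 * ph ^+ 2 / m ^+ 2)); last first.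
        by field; rewrite gt_eqF.
      apply: (@le_trans _ _ (G ^+ 2 * q)); first by rewrite ler_wpM2l// sqr_ge0.
      have Gq0 : 0 <= G ^+ 2 * q by rewrite mulr_ge0 ?sqr_ge0// ltW.
      have r1 : 1 <= 4 * ph ^+ 2 / m ^+ 2 by rewrite ler_pdivlMr// mul1r.
      exact: ler_peMr.
    have -> : - c * q * (1 + 4 / K2) = - c * q - c * (4 * q / K2).
      by field; rewrite gt_eqF.
    lra.
  have := sum_slopes DG G_le.
  have -> : \sum_j (kap * Phi j (l j) - (H j (l j) + g j (l j) * expR (- u j (l j))) -
      (kap * Phi j 0 - (H j 0 + g j 0 * expR (- u j 0)))) = eta.
    transitivity (kap * \sum_j (Phi j (l j) - Phi j 0) - - eta).
      by rewrite -sumF mulr_sumr -sumrB; apply: eq_bigr => j _; ring.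
    by rewrite sumPhi mulr0 sub0r opprK.
  move=> hq; rewrite /q2 ler_pdivrMr ?mulr_gt0//; apply: (le_trans hq).
  set P := 1 + 4 / K2 in K2' *.
  rewrite [leRHS](_ : _ = cs * (q * P * total_length)); last by ring.
  rewrite -!mulrA ler_pM2r; first by rewrite lerNl.
  by rewrite !mulr_gt0.
have hm : - u jm ym <= ln q1.
  by rewrite -[leLHS]expRK ler_ln// posrE expR_gt0.
have hn : ln q2 <= - u jn yn.
  by rewrite -[leRHS]expRK ler_ln// posrE expR_gt0.
move=> j y yj.
have h1 := oscu _ _ _ _ ymj yj; have h2 := oscu _ _ _ _ yj ynj.
have := ler_norm (ln q1); have := ler_norm (- ln q2); rewrite normrN => h3 h4.
have := normr_ge0 (ln q1); have := normr_ge0 (ln q2) => h5 h6.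
rewrite ler_norml; apply/andP; split; lra.
Qed.

End Graph.

(** * Integration of bounded measurable functions on a segment *)

Section BoundedMeasurable.
Context {R : realType}.
Notation mu := (@lebesgue_measure R).
Implicit Types (a b c d y : R) (f g : R -> R).

(** Measurable and bounded on the segment [[a, b]]. *)
Definition bmeas a b f : Prop :=
  measurable_fun `[a, b] f /\
  exists M : R, forall y, y \in `[a, b] -> `|f y| <= M.

Lemma bmeas_integrable a b f : bmeas a b f ->
  mu.-integrable `[a, b] (EFin \o f).
Proof.
move=> [mf [M hM]]; apply: measurable_bounded_integrable => //.
  by apply: compact_finite_measure; exact: segment_compact.
exists M; split; first exact: num_real.
by move=> N MN y /= yab; apply: le_trans (ltW MN); exact: hM.
Qed.

Lemma bmeas_cont a b f : {within `[a, b], continuous f} -> bmeas a b f.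
Proof.
move=> cf; split; last by have [M _ hM] := within_continuous_bounded cf; exists M.
exact: subspace_continuous_measurable_fun.
Qed.

Lemma bmeasM a b f g : bmeas a b f -> bmeas a b g ->
  bmeas a b (fun y => f y * g y).
Proof.
move=> [mf [M hM]] [mg [N hN]]; split; first exact: measurable_funM.
exists (M * N) => y yab; rewrite normrM ler_pM//; [exact: hM|exact: hN].
Qed.

Lemma bmeas_sub a b c d f : a <= c -> d <= b -> bmeas a b f -> bmeas c d f.
Proof.
move=> ac db [mf [M hM]].
have sub : `[c, d] `<=` `[a, b] by apply: subset_itv; rewrite bnd_simp.
split; first exact: measurable_funS mf.
by exists M => y /sub yab; exact: hM.
Qed.

Lemma bmeas_lim a b (F : nat -> R -> R) f (M : R) :
  (forall n, measurable_fun `[a, b] (F n)) ->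
  (forall n y, y \in `[a, b] -> `|F n y| <= M) ->
  (forall y, y \in `[a, b] -> F n y @[n --> \oo] --> f y) ->
  bmeas a b f.
Proof.
move=> mF hM cF; split; first by apply: (measurable_fun_cvg mF) => y yab; exact: cF.
exists M => y yab.
have h : `|F n y| @[n --> \oo] --> `|f y| by apply: cvg_norm; exact: cF.
rewrite -(cvg_lim _ h)//; apply: limr_le; first by apply: cvgP h.
by apply: nearW => n; exact: hM.
Qed.

Lemma int_le a b f g : bmeas a b f -> bmeas a b g ->
  (forall y, y \in `[a, b] -> f y <= g y) ->
  \int[mu]_(r in `[a, b]) f r <= \int[mu]_(r in `[a, b]) g r.
Proof. by move=> bf bg fg; apply: le_Rintegral => //; exact: bmeas_integrable. Qed.

Lemma int_lim a b (F : nat -> R -> R) f (M : R) :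
  (forall n, measurable_fun `[a, b] (F n)) ->
  (forall n y, y \in `[a, b] -> `|F n y| <= M) ->
  (forall y, y \in `[a, b] -> F n y @[n --> \oo] --> f y) ->
  \int[mu]_(r in `[a, b]) F n r @[n --> \oo] -->
  \int[mu]_(r in `[a, b]) f r.
Proof.
move=> mF hM cF; have bf := bmeas_lim mF hM cF.
have bM : bmeas a b (fun=> M) by apply: bmeas_cont => x; exact: cst_continuous.
have mF' n : measurable_fun `[a, b] (EFin \o F n) by apply/measurable_EFinP.
have mf : measurable_fun `[a, b] (EFin \o f).
  by apply/measurable_EFinP; case: bf.
have aeF : {ae mu, forall x, `[a, b]%classic x -> ((F n x)%:E @[n --> \oo] --> (f x)%:E)}.
  by apply: aeW => y yab; apply: cvg_EFin; [exact: nearW|exact: cF].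
have aeM : {ae mu, forall x n, `[a, b]%classic x -> (`|(F n x)%:E| <= M%:E)%E}.
  by apply: aeW => y n yab; rewrite /= lee_fin; exact: hM.
have [_ _ h] := @dominated_convergence _ _ R mu `[a, b] (measurable_itv _)
  (fun n => EFin \o F n) _ (EFin \o (fun=> M)) mF' mf aeF
  (bmeas_integrable bM) aeM.
rewrite /Rintegral.
have fi : (\int[mu]_(x in `[a, b]) (EFin \o f) x)%E \is a fin_num.
  by apply: integrable_fin_num => //; exact: bmeas_integrable.
rewrite -(fineK fi) in h.
have [_ h2] := (fine_cvgP _ _).1 h.
exact: h2.
Qed.

Lemma int_split a b f y : a <= y -> y <= b -> bmeas a b f ->
  \int[mu]_(r in `[y, b]) f r =
  \int[mu]_(r in `[a, b]) f r - \int[mu]_(r in `[a, y]) f r.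
Proof.
move=> ay yb bf.
rewrite (Rintegral_itvB (bmeas_integrable bf)) ?bnd_simp//.
rewrite Rintegral_itv_obnd_cbnd//; apply: integrableS (bmeas_integrable bf) => //.
by apply: subset_itv; rewrite bnd_simp.
Qed.

Lemma int_continuous a b f : a <= b -> bmeas a b f ->
  {within `[a, b], continuous (fun y => \int[mu]_(r in `[a, y]) f r)}.
Proof.
move=> ab bf; exact: (parameterized_integral_continuous ab (bmeas_integrable bf)).
Qed.

Lemma int_D1on a b f : a <= b -> {within `[a, b], continuous f} ->
  D1on a b (fun y => \int[mu]_(r in `[a, y]) f r) f.
Proof.
move=> ab cf; have bf := bmeas_cont cf.
split; first exact: int_continuous.
move=> y yab; have := yab; rewrite in_itv/= => /andP[ay yb].
have cfy : {for y, continuous f}.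
  have := cf; rewrite (continuous_within_itvP _ (lt_trans ay yb)) => -[h _ _].
  exact: h.
have [df e] := continuous_FTC1_closed yb (bmeas_integrable bf) ay cfy.
by split; [exact: df|rewrite -derive1E; exact: e].
Qed.

End BoundedMeasurable.

(** * The resolvent of the Kirchhoff Laplacian *)

Section Hyperbolic.
Context {R : realType}.
Implicit Types x y : R.

Definition sinhR x := (expR x - expR (- x)) / 2.
Definition coshR x := (expR x + expR (- x)) / 2.

Lemma sinhR0 : sinhR 0 = 0.
Proof. by rewrite /sinhR oppr0 subrr mul0r. Qed.

Lemma coshR0 : coshR 0 = 1.
Proof. by rewrite /coshR oppr0 expR0; field. Qed.

Lemma sinhRD x y : sinhR (x + y) = sinhR x * coshR y + coshR x * sinhR y.
Proof. by rewrite /sinhR /coshR opprD !expRD; field. Qed.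

Lemma sinhR_gt0 x : 0 < x -> 0 < sinhR x.
Proof.
move=> x0; rewrite divr_gt0// subr_gt0 ltr_expR.
by rewrite (lt_trans _ x0)// oppr_lt0.
Qed.

Lemma sinhR_ge0 x : 0 <= x -> 0 <= sinhR x.
Proof.
rewrite le_eqVlt => /predU1P[<-|/sinhR_gt0/ltW//]; by rewrite sinhR0.
Qed.

Lemma coshR_gt0 x : 0 < coshR x.
Proof. by rewrite divr_gt0// addr_gt0// expR_gt0. Qed.

Lemma D1on_sinh (a b : R) f df : D1on a b f df ->
  D1on a b (fun y => sinhR (f y)) (fun y => df y * coshR (f y)).
Proof.
move=> hf; apply: D1on_eq (D1onZ 2^-1 (D1onB (D1on_exp hf) (D1on_exp (D1onN hf)))).
  by move=> y _; rewrite /coshR; field.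
by move=> y; rewrite /sinhR mulrC.
Qed.

Lemma D1on_cosh (a b : R) f df : D1on a b f df ->
  D1on a b (fun y => coshR (f y)) (fun y => df y * sinhR (f y)).
Proof.
move=> hf; apply: D1on_eq (D1onZ 2^-1 (D1onD (D1on_exp hf) (D1on_exp (D1onN hf)))).
  by move=> y _; rewrite /sinhR; field.
by move=> y; rewrite /coshR mulrC.
Qed.

End Hyperbolic.

Section Resolvent.
Context {R : realType} {I J : finType}.
Variables (s t : J -> I) (l : J -> R).
Hypothesis l_gt0 : forall j, 0 < l j.
Hypothesis incident : forall i, exists j, s j = i \/ t j = i.
Variable k : R.
Hypothesis k_gt0 : 0 < k.
Notation mu := (@lebesgue_measure R).
Implicit Types (a : I -> R) (f U g d : J -> R -> R).

Let sl j := sinhR (k * l j).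

Let sl_gt0 j : 0 < sl j.
Proof. by rewrite sinhR_gt0// mulr_gt0. Qed.

(** The integral of [sinh (k r) f(r)] over [[0, y]], on the edge [j]. *)
Definition kernel_left f j (y : R) : R :=
  \int[mu]_(r in `[0, y]) (sinhR (k * r) * f j r).

(** The integral of [sinh (k (l j - r)) f(r)] over [[y, l j]], written as a
    difference of two integrals from [0], for which differentiation in [y] is
    immediate. *)
Definition kernel_right f j (y : R) : R :=
  \int[mu]_(r in `[0, l j]) (sinhR (k * (l j - r)) * f j r) -
  \int[mu]_(r in `[0, y]) (sinhR (k * (l j - r)) * f j r).

(** The solution on the edge [j] of [- v'' + k^2 v = f] with boundary values
    [a (s j)] and [a (t j)]. *)
Definition res_edge a f j (y : R) : R :=
  (sinhR (k * (l j - y)) * (a (s j) + kernel_left f j y / k) +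
   sinhR (k * y) * (a (t j) + kernel_right f j y / k)) / sinhR (k * l j).

(** The coefficient of [a i] in Kirchhoff's law at [i] for the functions
    [res_edge a f], up to the factor [k]. *)
Definition res_weight i : R :=
  \sum_(j | s j == i) coshR (k * l j) / sinhR (k * l j) +
  \sum_(j | t j == i) coshR (k * l j) / sinhR (k * l j).

(** Kirchhoff's law at [i] for the functions [res_edge a f], solved for the
    value [a i].  A fixed point of [res_vert] is a vertex function for which
    Kirchhoff's law holds. *)
Definition res_vert a f i : R :=
  (\sum_(j | s j == i) (a (t j) + kernel_right f j 0 / k) / sinhR (k * l j) +
   \sum_(j | t j == i) (a (s j) + kernel_left f j (l j) / k) / sinhR (k * l j)) /
  res_weight i.

Lemma res_weight_gt0 i : 0 < res_weight i.
Proof.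
have pos j : 0 < coshR (k * l j) / sinhR (k * l j).
  by rewrite divr_gt0// ?coshR_gt0//; exact: sl_gt0.
have ge0 (P : pred J) : 0 <= \sum_(j | P j) coshR (k * l j) / sinhR (k * l j).
  by apply: sumr_ge0 => j _; exact: ltW.
have [j [ji|ji]] := incident i.
- rewrite ltr_pwDl// (bigD1 j)/=; last exact/eqP.
  by rewrite ltr_pwDl.
- rewrite ltr_wpDl// (bigD1 j)/=; last exact/eqP.
  by rewrite ltr_pwDl.
Qed.

Lemma D1on_kl j : D1on 0 (l j) (fun r => k * (l j - r)) (fun=> - k).
Proof.
apply: D1on_eq (D1onZ k (D1onB (D1on_cst 0 (l j) (l j)) (D1on_id 0 (l j)))) => //.
by move=> y _; rewrite sub0r mulrN1.
Qed.

Lemma D1on_k j : D1on 0 (l j) (fun r => k * r) (fun=> k).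
Proof.
apply: D1on_eq (D1onZ k (D1on_id 0 (l j))) => //.
by move=> y _; rewrite mulr1.
Qed.

Lemma bmeas_kl f j : bmeas 0 (l j) (f j) ->
  bmeas 0 (l j) (fun r => sinhR (k * r) * f j r).
Proof.
by apply: bmeasM; apply: bmeas_cont; exact: D1on_cont (D1on_sinh (D1on_k j)).
Qed.

Lemma bmeas_kr f j : bmeas 0 (l j) (f j) ->
  bmeas 0 (l j) (fun r => sinhR (k * (l j - r)) * f j r).
Proof.
by apply: bmeasM; apply: bmeas_cont; exact: D1on_cont (D1on_sinh (D1on_kl j)).
Qed.

Lemma kernel_left_le f f' j (y : R) : 0 <= y -> y <= l j ->
  bmeas 0 (l j) (f j) -> bmeas 0 (l j) (f' j) ->
  (forall r : R, r \in `[0, l j] -> f j r <= f' j r) ->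
  kernel_left f j y <= kernel_left f' j y.
Proof.
move=> y0 yl bf bf' ff'; apply: int_le.
- by apply: bmeas_sub (bmeas_kl bf).
- by apply: bmeas_sub (bmeas_kl bf').
move=> r; rewrite in_itv/= => /andP[r0 ry]; rewrite ler_wpM2l//.
  by rewrite sinhR_ge0// mulr_ge0// ltW.
by rewrite ff'// in_itv/= r0 (le_trans ry yl).
Qed.

Lemma kernel_right_le f f' j (y : R) : 0 <= y -> y <= l j ->
  bmeas 0 (l j) (f j) -> bmeas 0 (l j) (f' j) ->
  (forall r : R, r \in `[0, l j] -> f j r <= f' j r) ->
  kernel_right f j y <= kernel_right f' j y.
Proof.
move=> y0 yl bf bf' ff'; rewrite /kernel_right -!int_split//; try exact: bmeas_kr.
apply: int_le.
- by apply: bmeas_sub (bmeas_kr bf).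
- by apply: bmeas_sub (bmeas_kr bf').
move=> r; rewrite in_itv/= => /andP[yr rl]; rewrite ler_wpM2l//.
  by rewrite sinhR_ge0// mulr_ge0 ?subr_ge0// ltW.
by rewrite ff'// in_itv/= rl (le_trans y0 yr).
Qed.

Lemma res_edge_le a a' f f' : (forall i, a i <= a' i) ->
  (forall j, bmeas 0 (l j) (f j)) -> (forall j, bmeas 0 (l j) (f' j)) ->
  (forall j (y : R), y \in `[0, l j] -> f j y <= f' j y) ->
  forall j (y : R), y \in `[0, l j] -> res_edge a f j y <= res_edge a' f' j y.
Proof.
move=> aa bf bf' ff' j y; rewrite in_itv/= => /andP[y0 yl].
rewrite ler_pM2r ?invr_gt0 ?sl_gt0// lerD// ler_wpM2l ?lerD//.
- by rewrite sinhR_ge0// mulr_ge0 ?subr_ge0// ltW.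
- by rewrite ler_pM2r ?invr_gt0//; apply: kernel_left_le => //; exact: ff'.
- by rewrite sinhR_ge0// mulr_ge0// ltW.
- by rewrite ler_pM2r ?invr_gt0//; apply: kernel_right_le => //; exact: ff'.
Qed.

Lemma res_vert_le a a' f f' : (forall i, a i <= a' i) ->
  (forall j, bmeas 0 (l j) (f j)) -> (forall j, bmeas 0 (l j) (f' j)) ->
  (forall j (y : R), y \in `[0, l j] -> f j y <= f' j y) ->
  forall i, res_vert a f i <= res_vert a' f' i.
Proof.
move=> aa bf bf' ff' i.
rewrite ler_pM2r ?invr_gt0 ?res_weight_gt0// lerD// ler_sum// => j _.
- rewrite ler_pM2r ?invr_gt0 ?sl_gt0// lerD// ler_pM2r ?invr_gt0//.
  by apply: kernel_right_le => //; [exact: ltW|exact: ff'].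
- rewrite ler_pM2r ?invr_gt0 ?sl_gt0// lerD// ler_pM2r ?invr_gt0//.
  by apply: kernel_left_le => //; [exact: ltW|exact: ff'].
Qed.

Lemma res_edge0 a f j : res_edge a f j 0 = a (s j).
Proof.
rewrite /res_edge /kernel_left mulr0 sinhR0 mul0r addr0 subr0 set_itv1.
rewrite /Rintegral integral_set1 /= mul0r addr0 mulrAC divff ?mul1r//.
by rewrite gt_eqF// sl_gt0.
Qed.

Lemma res_edgel a f j : res_edge a f j (l j) = a (t j).
Proof.
rewrite /res_edge /kernel_right !subrr mulr0 sinhR0 mul0r add0r mul0r addr0 mulrAC.
by rewrite divff ?mul1r// gt_eqF// sl_gt0.
Qed.

(** Green's representation: a function on the graph is recovered from its
    vertex values and from [k^2 U - U'']. *)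
Lemma resolvent_rep a U g d : netC2 s t l a U g d ->
  (forall j, {within `[0, l j], continuous (d j)}) ->
  let f := fun j y => k ^+ 2 * U j y - d j y in
  (forall j (y : R), y \in `[0, l j] -> res_edge a f j y = U j y) /\
  (forall i, res_vert a f i = a i).
Proof.
move=> S cd f; have [U0 Ul DU Dg K] := S.
have cf j : {within `[0, l j], continuous (f j)}.
  apply: within_continuousD; last exact: within_continuousN.
  by apply: within_continuousM; [exact: within_continuous_cst|exact: D1on_cont (DU j)].
have il j (y : R) : 0 <= y -> y <= l j -> kernel_left f j y =
    k * coshR (k * y) * U j y - sinhR (k * y) * g j y - k * U j 0.
  move=> y0 yl.
  have DP := D1onB (D1onM (D1onZ k (D1on_cosh (D1on_k j))) (DU j))
    (D1onM (D1on_sinh (D1on_k j)) (Dg j)).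
  rewrite /kernel_left (@ftc2 _ 0 y (fun r => k * coshR (k * r) * U j r -
    sinhR (k * r) * g j r) _ y0).
  - by rewrite mulr0 coshR0 sinhR0; ring.
  - apply: continuous_subspaceW (within_continuousM (D1on_cont (D1on_sinh (D1on_k j))) (cf j)).
    by apply: subset_itv; rewrite bnd_simp.
  - apply: D1on_sub (lexx 0) yl _; apply: D1on_eq DP => // r _.
    by rewrite /f; ring.
have ir j (y : R) : 0 <= y -> y <= l j -> kernel_right f j y =
    k * coshR (k * (l j - y)) * U j y + sinhR (k * (l j - y)) * g j y - k * U j (l j).
  move=> y0 yl.
  have DP := D1onN (D1onD (D1onM (D1onZ k (D1on_cosh (D1on_kl j))) (DU j))
    (D1onM (D1on_sinh (D1on_kl j)) (Dg j))).
  have cP := within_continuousM (D1on_cont (D1on_sinh (D1on_kl j))) (cf j).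
  have H z : 0 <= z -> z <= l j -> \int[mu]_(r in `[0, z]) (sinhR (k * (l j - r)) * f j r) =
    - (k * coshR (k * (l j - z)) * U j z + sinhR (k * (l j - z)) * g j z) +
    (k * coshR (k * l j) * U j 0 + sinhR (k * l j) * g j 0).
    move=> z0 zl; rewrite (@ftc2 _ 0 z (fun r => - (k * coshR (k * (l j - r)) * U j r +
      sinhR (k * (l j - r)) * g j r)) _ z0).
    - by rewrite subr0; ring.
    - by apply: continuous_subspaceW cP; apply: subset_itv; rewrite bnd_simp.
    - apply: D1on_sub (lexx 0) zl _; apply: D1on_eq DP => // r _.
      by rewrite /f; ring.
  rewrite /kernel_right !H ?(ltW (l_gt0 j))// subrr mulr0 coshR0 sinhR0; ring.
split.
- move=> j y; rewrite in_itv/= => /andP[y0 yl].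
  rewrite /res_edge il// ir// -U0 -Ul.
  have -> : sinhR (k * l j) = sinhR (k * y) * coshR (k * (l j - y)) +
      coshR (k * y) * sinhR (k * (l j - y)) by rewrite -sinhRD; congr sinhR; ring.
  have : sinhR (k * l j) != 0 by rewrite gt_eqF// sl_gt0.
  have -> : sinhR (k * l j) = sinhR (k * y) * coshR (k * (l j - y)) +
      coshR (k * y) * sinhR (k * (l j - y)) by rewrite -sinhRD; congr sinhR; ring.
  by move=> ne; field; rewrite ne gt_eqF.
- move=> i; rewrite /res_vert.
  have -> : \sum_(j | s j == i) (a (t j) + kernel_right f j 0 / k) / sinhR (k * l j) =
    a i * \sum_(j | s j == i) coshR (k * l j) / sinhR (k * l j) +
    k^-1 * \sum_(j | s j == i) g j 0.
    rewrite !mulr_sumr -big_split/=; apply: eq_bigr => j /eqP sji.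
    rewrite ir ?(ltW (l_gt0 j))// subr0 U0 Ul sji.
    by field; rewrite !gt_eqF// sl_gt0.
  have -> : \sum_(j | t j == i) (a (s j) + kernel_left f j (l j) / k) / sinhR (k * l j) =
    a i * \sum_(j | t j == i) coshR (k * l j) / sinhR (k * l j) -
    k^-1 * \sum_(j | t j == i) g j (l j).
    rewrite !mulr_sumr -sumrB; apply: eq_bigr => j /eqP tji.
    rewrite il ?(ltW (l_gt0 j))// U0 Ul tji.
    by field; rewrite !gt_eqF// sl_gt0.
  rewrite K addrA addrAC addrK.
  rewrite -mulrDr -/(res_weight i) mulfK//.
  by rewrite gt_eqF// res_weight_gt0.
Qed.


Lemma res_edge_continuous a f : (forall j, bmeas 0 (l j) (f j)) ->
  forall j, {within `[0, l j], continuous (res_edge a f j)}.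
Proof.
move=> bf j; have l0 := ltW (l_gt0 j).
apply: within_continuousM; last exact: within_continuous_cst.
apply: within_continuousD; apply: within_continuousM.
- exact: D1on_cont (D1on_sinh (D1on_kl j)).
- apply: within_continuousD; first exact: within_continuous_cst.
  apply: within_continuousM; last exact: within_continuous_cst.
  exact: int_continuous l0 (bmeas_kl (bf j)).
- exact: D1on_cont (D1on_sinh (D1on_k j)).
- apply: within_continuousD; first exact: within_continuous_cst.
  apply: within_continuousM; last exact: within_continuous_cst.
  apply: within_continuousD; first exact: within_continuous_cst.
  by apply: within_continuousN; exact: int_continuous l0 (bmeas_kr (bf j)).
Qed.

(** Conversely, a fixed point of [res_vert] gives a function on the graph that
    solves [- v'' + k^2 v = f]. *)
Lemma resolvent_C2 a f : (forall j, {within `[0, l j], continuous (f j)}) ->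
  (forall i, res_vert a f i = a i) ->
  exists g, netC2 s t l a (res_edge a f) g
    (fun j y => k ^+ 2 * res_edge a f j y - f j y).
Proof.
move=> cf aE.
pose g j y := k * (coshR (k * y) * (a (t j) + kernel_right f j y / k) -
  coshR (k * (l j - y)) * (a (s j) + kernel_left f j y / k)) / sinhR (k * l j).
have sl0 j : sinhR (k * l j) != 0 by rewrite gt_eqF// sl_gt0.
have k0 : k != 0 by rewrite gt_eqF.
have DL j := int_D1on (ltW (l_gt0 j))
  (within_continuousM (D1on_cont (D1on_sinh (D1on_k j))) (cf j)).
have DR j := int_D1on (ltW (l_gt0 j))
  (within_continuousM (D1on_cont (D1on_sinh (D1on_kl j))) (cf j)).
have DA j := D1onD (D1on_cst 0 (l j) (a (s j))) (D1onZ k^-1 (DL j)).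
have DB j := D1onD (D1on_cst 0 (l j) (a (t j))) (D1onZ k^-1
  (D1onB (D1on_cst 0 (l j) (\int[mu]_(r in `[0, l j]) (sinhR (k * (l j - r)) * f j r))) (DR j))).
exists g; split.
- exact: res_edge0.
- exact: res_edgel.
- move=> j.
  have DU := D1onZ (sinhR (k * l j))^-1 (D1onD (D1onM (D1on_sinh (D1on_kl j)) (DA j))
    (D1onM (D1on_sinh (D1on_k j)) (DB j))).
  apply: D1on_eq DU; last first.
    by move=> y; rewrite /res_edge /kernel_left /kernel_right mulrC; congr (_ / _);
      rewrite ![_ / k]mulrC.
  move=> y _; rewrite /g /kernel_left /kernel_right.
  move: (\int[mu]_(r in `[0, y]) (sinhR (k * r) * f j r))
    (\int[mu]_(r in `[0, y]) (sinhR (k * (l j - r)) * f j r))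
    (\int[mu]_(r in `[0, l j]) (sinhR (k * (l j - r)) * f j r)) => A B C.
  by field; rewrite k0 sl0.
- move=> j.
  have Dg := D1onZ (k / sinhR (k * l j)) (D1onB (D1onM (D1on_cosh (D1on_k j)) (DB j))
    (D1onM (D1on_cosh (D1on_kl j)) (DA j))).
  apply: D1on_eq Dg; last first.
    by move=> y; rewrite /g /kernel_left /kernel_right ![_ / k]mulrC mulrAC.
  move=> y _; rewrite /res_edge /kernel_left /kernel_right.
  move: (\int[mu]_(r in `[0, y]) (sinhR (k * r) * f j r))
    (\int[mu]_(r in `[0, y]) (sinhR (k * (l j - r)) * f j r))
    (\int[mu]_(r in `[0, l j]) (sinhR (k * (l j - r)) * f j r)) => A B C.
  have e : sinhR (k * l j) = sinhR (k * y) * coshR (k * (l j - y)) +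
      coshR (k * y) * sinhR (k * (l j - y)) by rewrite -sinhRD; congr sinhR; ring.
  have := sl0 j; rewrite e => ne.
  by field; rewrite k0 ne.
- move=> i; have := aE i; rewrite /res_vert => /(congr1 (fun x => x * res_weight i)).
  rewrite mulfVK ?gt_eqF ?res_weight_gt0// /res_weight mulrDr => e.
  have e1 : \sum_(j | s j == i) g j 0 = k *
      (\sum_(j | s j == i) (a (t j) + kernel_right f j 0 / k) / sinhR (k * l j) -
       a i * \sum_(j | s j == i) coshR (k * l j) / sinhR (k * l j)).
    rewrite [a i * _]mulr_sumr -sumrB mulr_sumr; apply: eq_bigr => j /eqP <-.
    rewrite /g mulr0 coshR0 mul1r subr0.
    have -> : kernel_left f j 0 = 0.
      by rewrite /kernel_left set_itv1 /Rintegral integral_set1.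
    by field; rewrite k0 sl0.
  have e2 : \sum_(j | t j == i) g j (l j) = k *
      (a i * \sum_(j | t j == i) coshR (k * l j) / sinhR (k * l j) -
       \sum_(j | t j == i) (a (s j) + kernel_left f j (l j) / k) / sinhR (k * l j)).
    rewrite [a i * _]mulr_sumr -sumrB mulr_sumr; apply: eq_bigr => j /eqP <-.
    rewrite /g subrr mulr0 coshR0 mul1r.
    have -> : kernel_right f j (l j) = 0 by rewrite /kernel_right subrr.
    by field; rewrite k0 sl0.
  by rewrite e1 e2; congr (k * _); lra.
Qed.

Lemma resolvent_lim (a : nat -> I -> R) (f : nat -> J -> R -> R) a' f' (M : R) :
  (forall n j, measurable_fun `[0, l j] (f n j)) ->
  (forall n j (y : R), y \in `[0, l j] -> `|f n j y| <= M) ->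
  (forall i, a n i @[n --> \oo] --> a' i) ->
  (forall j (y : R), y \in `[0, l j] -> f n j y @[n --> \oo] --> f' j y) ->
  (forall j (y : R), y \in `[0, l j] ->
    res_edge (a n) (f n) j y @[n --> \oo] --> res_edge a' f' j y) /\
  (forall i, res_vert (a n) (f n) i @[n --> \oo] --> res_vert a' f' i).
Proof.
move=> mf fM ca cf.
have lim (q : R -> R) j (y : R) : {within `[0, l j], continuous q} ->
    0 <= y -> y <= l j ->
    \int[mu]_(r in `[0, y]) (q r * f n j r) @[n --> \oo] -->
    \int[mu]_(r in `[0, y]) (q r * f' j r).
  move=> cq y0 yl; have [Q Q0 hQ] := within_continuous_bounded cq.
  have sub : `[0, y] `<=` `[0, l j] by apply: subset_itv; rewrite bnd_simp.
  apply: (@int_lim _ _ _ _ _ (Q * M)).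
  - move=> n; apply: measurable_funM; last exact: measurable_funS (mf n j).
    by apply: measurable_funS (bmeas_cont cq).1.
  - by move=> n r /sub rl; rewrite normrM ler_pM// ?hQ// fM.
  - by move=> r /sub rl; apply: cvgM; [exact: cvg_cst|exact: cf].
have cl j (y : R) : 0 <= y -> y <= l j ->
    kernel_left (f n) j y @[n --> \oo] --> kernel_left f' j y.
  by move=> y0 yl; apply: lim => //; exact: D1on_cont (D1on_sinh (D1on_k j)).
have cr j (y : R) : 0 <= y -> y <= l j ->
    kernel_right (f n) j y @[n --> \oo] --> kernel_right f' j y.
  by move=> y0 yl; apply: cvgB; apply: (lim (fun r => sinhR (k * (l j - r)))) => //;
    try exact: D1on_cont (D1on_sinh (D1on_kl j)); exact: ltW.
split.
- move=> j y; rewrite in_itv/= => /andP[y0 yl].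
  apply: cvgMr_tmp; apply: cvgD; apply: cvgMl_tmp; apply: cvgD => //; apply: cvgMr_tmp.
    exact: cl.
  exact: cr.
- move=> i; apply: cvgMr_tmp; apply: cvgD; apply: cvg_big => [|j _].
  + exact: add_continuous.
  + apply: cvgMr_tmp; apply: cvgD => //; apply: cvgMr_tmp.
    by apply: cr => //; exact: ltW.
  + exact: add_continuous.
  + apply: cvgMr_tmp; apply: cvgD => //; apply: cvgMr_tmp.
    by apply: cl => //; exact: ltW.
Qed.

End Resolvent.

(** * Monotone iteration *)

Section Iteration.
Context {R : realType} {I J : finType}.
Variables (s t : J -> I) (l : J -> R).
Hypothesis l_gt0 : forall j, 0 < l j.
Hypothesis incident : forall i, exists j, s j = i \/ t j = i.
Variable h : J -> R -> R.
Hypothesis ch : forall j, {within `[0, l j], continuous (h j)}.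
Implicit Types (c k M b : R) (U V : J -> R -> R).

(** The right-hand side for which a fixed point of the resolvent is a
    solution: [U'' = k^2 U - nl U = c - h exp(U)]. *)
Definition nl k c U j (y : R) : R := k ^+ 2 * U j y + h j y * expR (U j y) - c.

(** Vertex values together with edge functions.  No compatibility at the
    endpoints is required: the iteration only reaches it in the limit. *)
Definition state : Type := ((I -> R) * (J -> R -> R))%type.
Implicit Types x : state.

Definition step k c x : state :=
  (res_vert s t l k x.1 (nl k c x.2), res_edge s t l k x.1 (nl k c x.2)).

(** The iterates that start from the constant [- M]. *)
Definition iter_state k M c n : state :=
  iter n (step k c) ((fun=> - M), (fun _ _ => - M)).

Definition le_state x x' : Prop := (forall i, x.1 i <= x'.1 i) /\
  (forall j (y : R), y \in `[0, l j] -> x.2 j y <= x'.2 j y).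

(** The constant function [b]. *)
Definition cst_state b : state := ((fun=> b), (fun _ _ => b)).

Definition cont_state x : Prop :=
  forall j, {within `[0, l j], continuous (x.2 j)}.

Lemma le_state_trans x2 x1 x3 : le_state x1 x2 -> le_state x2 x3 -> le_state x1 x3.
Proof.
move=> [h1 h2] [h3 h4]; split=> [i|j y yj].
  exact: le_trans (h1 i) (h3 i).
exact: le_trans (h2 j y yj) (h4 j y yj).
Qed.

Lemma nl_cont k c U : (forall j, {within `[0, l j], continuous (U j)}) ->
  forall j, {within `[0, l j], continuous (nl k c U j)}.
Proof.
move=> cU j; apply: within_continuousD; last exact: within_continuous_cst.
apply: within_continuousD; first by apply: within_continuousM; [exact: within_continuous_cst|exact: cU].
by apply: within_continuousM; [exact: ch|exact: within_continuous_expR].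
Qed.

Lemma step_cont k c x : cont_state x -> cont_state (step k c x).
Proof.
move=> cx j; apply: res_edge_continuous => // i.
by apply: bmeas_cont; exact: nl_cont.
Qed.

Lemma iter_cont k M c n : cont_state (iter_state k M c n).
Proof.
elim: n => [|n IH]; first by move=> j; exact: within_continuous_cst.
exact: step_cont.
Qed.

Lemma nonlinearity_mono k b (q u v : R) : `|q| * expR b <= k ^+ 2 ->
  u <= v -> v <= b ->
  k ^+ 2 * u + q * expR u <= k ^+ 2 * v + q * expR v.
Proof.
move=> qk uv vb.
have d0 : 0 <= expR v - expR u by rewrite subr_ge0 ler_expR.
have d1 : expR v - expR u <= expR b * (v - u).
  have e1 : expR v * (1 + (u - v)) <= expR u.
    rewrite [in leRHS](_ : u = v + (u - v)); last by ring.
    by rewrite expRD ler_pM2l ?expR_gt0// expR_ge1Dx.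
  have : expR v * (v - u) <= expR b * (v - u).
    by rewrite ler_wpM2r ?subr_ge0// ler_expR.
  lra.
have h1 : - (`|q| * (expR v - expR u)) <= q * (expR v - expR u).
  rewrite -mulNr ler_wpM2r//; have := ler_norm (- q); rewrite normrN; lra.
have h2 : `|q| * (expR v - expR u) <= `|q| * (expR b * (v - u)).
  by rewrite ler_wpM2l.
have h3 : `|q| * expR b * (v - u) <= k ^+ 2 * (v - u).
  by rewrite ler_wpM2r// subr_ge0.
lra.
Qed.

Section FixedK.
Variables (k b : R).
Hypothesis k_gt0 : 0 < k.
Hypothesis k_large : forall j (y : R), y \in `[0, l j] -> `|h j y| * expR b <= k ^+ 2.

(** The order is preserved as long as the larger function stays below the
    number [b] for which [k] is large enough; a smaller constant [c'] gives a
    larger right-hand side. *)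
Lemma step_mono c c' x x' : c' <= c -> cont_state x -> cont_state x' ->
  le_state x x' -> le_state x' (cst_state b) ->
  le_state (step k c x) (step k c' x').
Proof.
move=> cc cx cx' [a_le U_le] [_ U_b].
have nl_le j (y : R) : y \in `[0, l j] -> nl k c x.2 j y <= nl k c' x'.2 j y.
  move=> yj; rewrite /nl lerB//.
  by apply: (nonlinearity_mono (k_large yj)); [exact: U_le|exact: U_b].
have bn d z : cont_state z -> forall j, bmeas 0 (l j) (nl k d z.2 j).
  by move=> cz j; apply: bmeas_cont; exact: nl_cont.
split=> [i|j y yj] /=.
- by apply: res_vert_le => //; exact: bn.
- by apply: res_edge_le => //; exact: bn.
Qed.

Lemma step_sol c (a : I -> R) U (g : J -> R -> R) : sol s t l h c a U g ->
  le_state (step k c (a, U)) (a, U) /\ le_state (a, U) (step k c (a, U)).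
Proof.
move=> S; have [_ _ DU _ _] := S.
have cd j : {within `[0, l j], continuous (fun y => c - h j y * expR (U j y))}.
  apply: within_continuousD; first exact: within_continuous_cst.
  by apply: within_continuousN; apply: within_continuousM => //; exact: within_continuous_expR (D1on_cont (DU j)).
have [e1 e2] := resolvent_rep l_gt0 incident k_gt0 S cd.
have nlE : (fun j y => k ^+ 2 * U j y - (c - h j y * expR (U j y))) = nl k c U.
  by apply/funext => j; apply/funext => y; rewrite /nl; ring.
rewrite nlE in e1 e2.
by split; split=> /= [i|j y yj]; rewrite ?e1// ?e2.
Qed.

(** Any solution for a constant [c' <= c] that lies above [- M] bounds the
    iterates for [c]. *)
Lemma iter_le_sol M c c' (a : I -> R) U (g : J -> R -> R) :
  sol s t l h c' a U g -> c' <= c ->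
  le_state (cst_state (- M)) (a, U) -> le_state (a, U) (cst_state b) ->
  forall n, le_state (iter_state k M c n) (a, U).
Proof.
move=> S cc lo up; elim=> [//|n IH].
have [_ _ DU _ _] := S.
apply: (@le_state_trans (step k c' (a, U))); last by have [] := step_sol S.
have cU : cont_state (a, U) by move=> j; exact: D1on_cont (DU j).
exact: (step_mono cc (@iter_cont k M c n) cU IH up).
Qed.

Lemma iter_le_next M c n :
  (forall j (y : R), y \in `[0, l j] -> c <= h j y * expR (- M)) ->
  (forall n, le_state (iter_state k M c n) (cst_state b)) ->
  le_state (iter_state k M c n) (iter_state k M c n.+1).
Proof.
move=> lo up; elim: n => [|n IH]; last first.
  exact: (step_mono (lexx c) (@iter_cont k M c n) (@iter_cont k M c n.+1) IH (up n.+1)).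
have S : netC2 s t l (fun=> - M) (fun _ _ => - M) (fun _ _ => 0) (fun _ _ => 0).
  by split => // [j|j|i]; [exact: D1on_cst|exact: D1on_cst|rewrite !big1].
have cd j : {within `[0, l j], continuous (fun _ : R => 0 : R)}.
  exact: within_continuous_cst.
have [e1 e2] := resolvent_rep l_gt0 incident k_gt0 S cd.
have c0 : forall j, {within `[0, l j], continuous (fun _ : R => - M)}.
  by move=> j; exact: within_continuous_cst.
have bf j : bmeas 0 (l j) (fun _ : R => k ^+ 2 * - M - 0).
  by apply: bmeas_cont; exact: within_continuous_cst.
have bn j : bmeas 0 (l j) (nl k c (fun _ _ => - M) j).
  by apply: bmeas_cont; apply: nl_cont.
have fle j (y : R) : y \in `[0, l j] -> k ^+ 2 * - M - 0 <= nl k c (fun _ _ => - M) j y.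
  by move=> yj; have := lo j y yj; rewrite /nl; lra.
split=> [i|j y yj] /=.
- by rewrite -[leLHS](e2 i); apply: res_vert_le => //.
- by rewrite -[leLHS](e1 j y yj); apply: res_edge_le => //.
Qed.

Lemma nl_bound M c U j (y : R) : y \in `[0, l j] -> - M <= U j y -> U j y <= b ->
  `|nl k c U j y| <= k ^+ 2 * (`|M| + `|b| + 1) + `|c|.
Proof.
move=> yj lo up; rewrite (le_trans (ler_normB _ _))// lerD2r.
rewrite (le_trans (ler_normD _ _))//.
rewrite [`|k ^+ 2 * _|]normrM [`|h j y * _|]normrM mulrDr mulr1 lerD//.
  rewrite [`|k ^+ 2|]ger0_norm ?sqr_ge0// ler_wpM2l ?sqr_ge0//.
  have := ler_norm M; have := ler_norm b; have := normr_ge0 M; have := normr_ge0 b.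
  by rewrite ler_norml => *; apply/andP; split; lra.
rewrite [`|expR _|]ger0_norm ?expR_ge0//.
by apply: le_trans (k_large yj); rewrite ler_wpM2l// ler_expR.
Qed.

Lemma iter_ge M c n :
  (forall j (y : R), y \in `[0, l j] -> c <= h j y * expR (- M)) ->
  (forall n, le_state (iter_state k M c n) (cst_state b)) ->
  le_state (cst_state (- M)) (iter_state k M c n).
Proof.
move=> lo up; elim: n => [//|n IH]; apply: le_state_trans IH _.
exact: iter_le_next.
Qed.

(** Bounded iterates increase to a solution, which is below every upper bound
    of the iterates. *)
Lemma iter_limit M c :
  (forall j (y : R), y \in `[0, l j] -> c <= h j y * expR (- M)) ->
  (forall n, le_state (iter_state k M c n) (cst_state b)) ->
  exists a U g, sol s t l h c a U g /\
    forall x, (forall n, le_state (iter_state k M c n) x) -> le_state (a, U) x.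
Proof.
move=> lo up.
pose v := iter_state k M c.
have mono n := iter_le_next n lo up.
have lower n := iter_ge n lo up.
pose a i : R := limn (fun n => (v n).1 i).
pose U j (y : R) : R := limn (fun n => (v n).2 j y).
have ca i : (v n).1 i @[n --> \oo] --> a i.
  apply: nondecreasing_is_cvgn.
    by apply/nondecreasing_seqP => n; exact: (mono n).1.
  by exists b => _ [n _ <-]; exact: (up n).1.
have cU j (y : R) : y \in `[0, l j] -> (v n).2 j y @[n --> \oo] --> U j y.
  move=> yj; apply: nondecreasing_is_cvgn.
    by apply/nondecreasing_seqP => n; exact: (mono n).2.
  by exists b => _ [n _ <-]; exact: (up n).2.
have cf j (y : R) : y \in `[0, l j] ->
    nl k c (v n).2 j y @[n --> \oo] --> nl k c U j y.
  move=> yj; apply: cvgB; last exact: cvg_cst.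
  apply: cvgD; apply: cvgMl_tmp; first exact: cU.
  by apply: continuous_cvg; [exact: continuous_expR|exact: cU].
have mf n j : measurable_fun `[0, l j] (nl k c (v n).2 j).
  by apply: (bmeas_cont _).1; apply: nl_cont; exact: iter_cont.
pose K := k ^+ 2 * (`|M| + `|b| + 1) + `|c|.
have fK n j (y : R) : y \in `[0, l j] -> `|nl k c (v n).2 j y| <= K.
  by move=> yj; apply: nl_bound => //; [exact: (lower n).2|exact: (up n).2].
have [lE lV] := resolvent_lim s t l_gt0 k mf fK ca cf.
have bf j : bmeas 0 (l j) (nl k c U j).
  exact: (bmeas_lim (fun n => mf n j) (fun n => fK n j) (cf j)).
have aE i : res_vert s t l k a (nl k c U) i = a i.
  have h1 : (v n.+1).1 i @[n --> \oo] --> a i by rewrite (cvg_shiftS (fun n => (v n).1 i)).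
  exact: (cvg_unique _ (lV i) h1).
have UE j (y : R) : y \in `[0, l j] -> res_edge s t l k a (nl k c U) j y = U j y.
  move=> yj.
  have h1 : (v n.+1).2 j y @[n --> \oo] --> U j y.
    by rewrite (cvg_shiftS (fun n => (v n).2 j y)); exact: cU.
  exact: (cvg_unique _ (lE j y yj) h1).
(* The limit [U] is only known to be measurable. It agrees on the edges with
[V], which is continuous, and feeding [V] back into the resolvent gives a
twice differentiable function [W] that agrees with both. *)
pose V := res_edge s t l k a (nl k c U).
have cV j : {within `[0, l j], continuous (V j)} by exact: res_edge_continuous.
have nlE j (y : R) : y \in `[0, l j] -> nl k c V j y = nl k c U j y.
  by move=> yj; rewrite /nl /V UE.
have cnV j : {within `[0, l j], continuous (nl k c V j)} by exact: nl_cont.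
have bV j : bmeas 0 (l j) (nl k c V j) by exact: bmeas_cont.
have VU j (y : R) : y \in `[0, l j] -> nl k c V j y <= nl k c U j y.
  by move=> yj; rewrite nlE.
have UV j (y : R) : y \in `[0, l j] -> nl k c U j y <= nl k c V j y.
  by move=> yj; rewrite nlE.
pose W := res_edge s t l k a (nl k c V).
have WV j (y : R) : y \in `[0, l j] -> W j y = V j y.
  by move=> yj; apply/le_anti/andP; split; apply: res_edge_le.
have aE' i : res_vert s t l k a (nl k c V) i = a i.
  rewrite -[RHS]aE; apply/le_anti/andP; split; exact: res_vert_le.
have [g [W0 Wl DW Dg K0]] := resolvent_C2 l_gt0 incident k_gt0 cnV aE'.
exists a, W, g; split.
- split => // j; apply: D1on_eq (Dg j) => // y yj.
  have yj' : y \in `[0, l j] by apply: subset_itvW yj.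
  by rewrite /nl -/(W j y) WV//; ring.
- move=> x hx; split=> [i|j y yj] /=.
  + rewrite -(cvg_lim _ (ca i))//; apply: limr_le; first exact: cvgP (ca i).
    by apply: nearW => n; exact: (hx n).1.
  + rewrite WV// /V UE// -(cvg_lim _ (cU j y yj))//.
    apply: limr_le; first exact: cvgP (cU j y yj).
    by apply: nearW => n; exact: (hx n).2.
Qed.

(** For fixed [n], the [n]-th iterate depends continuously on the constant,
    provided that the iterates stay in a fixed range. *)
Lemma iter_cvg M (C : R) (cn : nat -> R) c : (forall m, `|cn m| <= C) ->
  cn m @[m --> \oo] --> c ->
  (forall m n, le_state (cst_state (- M)) (iter_state k M (cn m) n)) ->
  (forall m n, le_state (iter_state k M (cn m) n) (cst_state b)) ->
  forall n, (forall i, (iter_state k M (cn m) n).1 i @[m --> \oo] -->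
    (iter_state k M c n).1 i) /\
  (forall j (y : R), y \in `[0, l j] ->
    (iter_state k M (cn m) n).2 j y @[m --> \oo] --> (iter_state k M c n).2 j y).
Proof.
move=> cnC cnc lo up; elim=> [|n [IH1 IH2]].
  by split=> [i|j y _]; exact: cvg_cst.
pose K := k ^+ 2 * (`|M| + `|b| + 1) + C.
have [lE lV] : (forall j (y : R), y \in `[0, l j] ->
    res_edge s t l k (iter_state k M (cn m) n).1
      (nl k (cn m) (iter_state k M (cn m) n).2) j y @[m --> \oo] -->
    res_edge s t l k (iter_state k M c n).1 (nl k c (iter_state k M c n).2) j y) /\
  (forall i, res_vert s t l k (iter_state k M (cn m) n).1
      (nl k (cn m) (iter_state k M (cn m) n).2) i @[m --> \oo] -->
    res_vert s t l k (iter_state k M c n).1 (nl k c (iter_state k M c n).2) i).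
  apply: (resolvent_lim s t l_gt0 k (M := K)) => //.
  - by move=> m j; apply: (bmeas_cont _).1; apply: nl_cont; exact: iter_cont.
  - move=> m j y yj; apply: (@le_trans _ _ (k ^+ 2 * (`|M| + `|b| + 1) + `|cn m|)).
      by apply: nl_bound => //; [exact: (lo m n).2|exact: (up m n).2].
    by rewrite lerD2l.
  - move=> j y yj; apply: cvgB; last exact: cnc.
    apply: cvgD; apply: cvgMl_tmp; first exact: IH2.
    by apply: continuous_cvg; [exact: continuous_expR|exact: IH2].
by split.
Qed.


End FixedK.

End Iteration.

(** * Solvability at the critical constant on a metric graph *)

Section Critical.
Context {R : realType} {I J : finType}.
Variables (s t : J -> I) (l : J -> R).
Hypothesis l_gt0 : forall j, 0 < l j.
Hypothesis J0 : (0 < #|J|)%N.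
Hypothesis conn : forall P : I -> Prop, (exists i, P i) ->
  (forall j, P (s j) <-> P (t j)) -> forall i, P i.
Variable h : J -> R -> R.
Hypothesis ch : forall j, {within `[0, l j], continuous (h j)}.

Lemma connected_incident : forall i, exists j, s j = i \/ t j = i.
Proof.
have /card_gt0P[j0 _] := J0.
apply: (conn (P := fun i => exists j, s j = i \/ t j = i)).
  by exists (s j0), j0; left.
by move=> j; split=> _; exists j; [right|left].
Qed.

Lemma sol_vertex_bound (B c : R) a U g : sol s t l h c a U g ->
  (forall j (y : R), y \in `[0, l j] -> `|U j y| <= B) -> forall i, `|a i| <= B.
Proof.
move=> [U0 Ul _ _ _] UB i; have [j [<-|<-]] := connected_incident i.
- by rewrite -U0 UB// in_itv/= lexx ltW.
- by rewrite -Ul UB// in_itv/= lexx ltW.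
Qed.

Lemma exists_large_k (b : R) : exists2 k : R, 0 < k &
  forall j (y : R), y \in `[0, l j] -> `|h j y| * expR b <= k ^+ 2.
Proof.
have [Q Q0 hQ] := family_bounded ch.
have k1 : 1 <= Q * expR b + 1 by rewrite lerDr mulr_ge0 ?expR_ge0// ltW.
exists (Q * expR b + 1); first exact: lt_le_trans k1.
move=> j y yj; apply: (@le_trans _ _ (Q * expR b)).
  by rewrite ler_wpM2r ?expR_ge0// hQ.
move: k1; set q := Q * _ => k1; nra.
Qed.

Lemma exists_constant_subsolution (c b : R) : c < 0 -> exists2 M : R, b <= M &
  forall j (y : R), y \in `[0, l j] -> c <= h j y * expR (- M).
Proof.
move=> c0; have [Q Q0 hQ] := family_bounded ch.
have r0 : 0 < - c / Q by rewrite divr_gt0// oppr_gt0.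
exists (Num.max b (- ln (- c / Q))); first by rewrite le_max lexx.
move=> j y yj; set M := Num.max _ _.
have e1 : expR (- M) <= - c / Q.
  rewrite -[leRHS](@lnK R) ?posrE// ler_expR lerNl.
  by rewrite le_max lexx orbT.
have h1 := hQ j y yj.
have h2 : - (Q * expR (- M)) <= h j y * expR (- M).
  rewrite -mulNr ler_wpM2r ?expR_ge0//.
  by move: h1; rewrite ler_norml => /andP[].
apply: le_trans h2; rewrite lerNr.
by rewrite mulrC -ler_pdivlMr.
Qed.

(** The method of sub- and supersolutions, with a constant as subsolution and
    a solution for a smaller constant as supersolution. *)
Lemma sol_below (c c1 : R) a1 u1 g1 : sol s t l h c1 a1 u1 g1 -> c1 <= c -> c < 0 ->
  exists a u g, sol s t l h c a u g /\
    forall j (y : R), y \in `[0, l j] -> u j y <= u1 j y.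
Proof.
move=> S1 c1c c0; have [_ _ Du1 _ _] := S1.
have [b b0 ub] := family_bounded (fun j => D1on_cont (Du1 j)).
have ab := sol_vertex_bound S1 ub.
have [k k0 kl] := exists_large_k b.
have [M bM hM] := exists_constant_subsolution b c0.
have up1 : le_state l (a1, u1) (cst_state b).
  split=> [i|j y yj] /=.
    by apply: le_trans (ab i); exact: ler_norm.
  by apply: le_trans (ub j y yj); exact: ler_norm.
have lo1 : le_state l (cst_state (- M)) (a1, u1).
  split=> [i|j y yj] /=; rewrite lerNl (le_trans _ bM)//.
    by apply: le_trans (ab i); rewrite -normrN ler_norm.
  by apply: le_trans (ub j y yj); rewrite -normrN ler_norm.
have inc := connected_incident.
have itle := iter_le_sol l_gt0 inc ch k0 kl S1 c1c lo1 up1.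
have itb n : le_state l (iter_state s t l h k M c n) (cst_state b).
  exact: le_state_trans (itle n) up1.
have [a [u [g [S hS]]]] := iter_limit l_gt0 inc ch k0 kl hM itb.
by exists a, u, g; split => //; exact: (hS _ itle).2.
Qed.

(** If the problem is solvable for all constants in [(- cs, 0)] and [h] has a
    negative integral, then it is solvable for [- cs]. *)
Theorem critical_solution (cs : R) (H : J -> R -> R) : 0 < cs ->
  (forall j, D1on 0 (l j) (H j) (h j)) ->
  \sum_j (H j (l j) - H j 0) < 0 ->
  (forall c : R, - cs < c -> c < 0 -> exists a u g, sol s t l h c a u g) ->
  exists a u g, sol s t l h (- cs) a u g.
Proof.
move=> cs0 DH H0 ex.
have [B hB] := sol_apriori l_gt0 ch conn cs0 J0 DH H0.
have inc := connected_incident.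
have exB (c : R) : - cs < c -> c <= - (cs / 2) -> exists a u g,
    sol s t l h c a u g /\ forall j (y : R), y \in `[0, l j] -> `|u j y| <= B.
  move=> cl cr; have c0 : c < 0 by lra.
  have [||a1 [u1 [g1 S1]]] := ex ((c - cs) / 2); [lra|lra|].
  have c1c : (c - cs) / 2 < c by lra.
  have [a [u [g [S uu1]]]] := sol_below S1 (ltW c1c) c0.
  exists a, u, g; split => //; exact: (hB _ _ _ _ _ _ _ _ S S1 c1c (ltW cl) cr uu1).
have [k k0 kl] := exists_large_k B.
have c2 : - (cs / 2) < 0 by lra.
have [M BM hM] := exists_constant_subsolution B c2.
(* Constants in [(- cs, - cs / 2]] that tend to [- cs]. *)
pose cn (m : nat) : R := - cs + cs / 2 * (m.+1%:R)^-1.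
have cn_in m : - cs < cn m /\ cn m <= - (cs / 2).
  have i0 : 0 < (m.+1%:R)^-1 :> R by rewrite invr_gt0 ltr0Sn.
  have i1 : (m.+1%:R)^-1 <= 1 :> R by rewrite invf_le1 ?ltr0Sn// ler1n.
  move: i0 i1; rewrite /cn; move: (_^-1) => X X0 X1.
  split; first by rewrite ltrDl mulr_gt0// divr_gt0.
  have : cs / 2 * X <= cs / 2 * 1 by rewrite ler_pM2l// divr_gt0.
  lra.
have cnc : cn m @[m --> \oo] --> - cs.
  rewrite -[X in _ --> X]addr0 -[X in _ + X](mulr0 (cs / 2)).
  apply: cvgD; first exact: cvg_cst.
  by apply: cvgMl_tmp; exact: cvg_harmonic.
have up m n : le_state l (iter_state s t l h k M (cn m) n) (cst_state B).
  have [cl cr] := cn_in m.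
  have [a [u [g [S uB]]]] := exB _ cl cr.
  have aB := sol_vertex_bound S uB.
  have up1 : le_state l (a, u) (cst_state B).
    split=> [i|j y yj] /=.
      by apply: le_trans (aB i); exact: ler_norm.
    by apply: le_trans (uB j y yj); exact: ler_norm.
  have lo1 : le_state l (cst_state (- M)) (a, u).
    split=> [i|j y yj] /=; rewrite lerNl (le_trans _ BM)//.
      by apply: le_trans (aB i); rewrite -normrN ler_norm.
    by apply: le_trans (uB j y yj); rewrite -normrN ler_norm.
  apply: (le_state_trans _ up1).
  exact: (iter_le_sol l_gt0 inc ch k0 kl S (lexx _) lo1 up1).
have lo m n : le_state l (cst_state (- M)) (iter_state s t l h k M (cn m) n).
  apply: (iter_ge l_gt0 inc ch k0 kl) => // j y yj.
  by apply: le_trans (hM j y yj); exact: (cn_in m).2.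
have cnC m : `|cn m| <= cs.
  by have [? ?] := cn_in m; rewrite ler_norml; apply/andP; split; lra.
have lim := iter_cvg l_gt0 ch kl cnC cnc lo up.
have up' n : le_state l (iter_state s t l h k M (- cs) n) (cst_state B).
  have [l1 l2] := lim n; split=> [i|j y yj].
    rewrite -(cvg_lim _ (l1 i))//; apply: limr_le; first exact: cvgP (l1 i).
    by apply: nearW => m; exact: (up m n).1.
  rewrite -(cvg_lim _ (l2 j y yj))//; apply: limr_le; first exact: cvgP (l2 j y yj).
  by apply: nearW => m; exact: (up m n).2.
have hM' j (y : R) : y \in `[0, l j] -> - cs <= h j y * expR (- M).
  by move=> yj; apply: le_trans (hM j y yj); lra.
have [a [u [g [S _]]]] := iter_limit l_gt0 inc ch k0 kl hM' up'.
by exists a, u, g.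
Qed.

End Critical.

(** * From embedded networks to metric graphs *)

Section EndpointSlopes.
Context {R : realType}.
Implicit Types (l e : R) (f g : R -> R).

Lemma slope_at_start l f g : 0 < l -> D1on 0 l f g ->
  {within `[0, l], continuous g} -> forall e, 0 < e ->
  exists2 d : R, 0 < d & forall y : R, 0 < y -> y < l -> y < d ->
    `|g 0 - (f y - f 0) / y| <= e.
Proof.
move=> l0 Df cg e e0.
have [_ cg0 _] := (continuous_within_itvP g l0).1 cg.
have /cvgrPdist_le/(_ e e0) := cg0.
rewrite /at_right near_withinE => /nbhs_ballP[d /= d0 hd].
exists d => // y y0 yl yd.
have [cf f'] := D1on_sub (lexx 0) (ltW yl) Df.
have [z zy ->] := MVT y0 f' cf.
rewrite subr0 mulfK ?gt_eqF//; move: zy; rewrite in_itv/= => /andP[z0 zy].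
by apply: hd => //; rewrite /ball/= sub0r normrN gtr0_norm// (lt_trans zy).
Qed.

Lemma slope_at_end l f g : 0 < l -> D1on 0 l f g ->
  {within `[0, l], continuous g} -> forall e, 0 < e ->
  exists2 d : R, 0 < d & forall y : R, 0 < y -> y < l -> l - y < d ->
    `|g l - (f l - f y) / (l - y)| <= e.
Proof.
move=> l0 Df cg e e0.
have [_ _ cgl] := (continuous_within_itvP g l0).1 cg.
have /cvgrPdist_le/(_ e e0) := cgl.
rewrite /at_left near_withinE => /nbhs_ballP[d /= d0 hd].
exists d => // y y0 yl yd.
have [cf f'] := D1on_sub (ltW y0) (lexx l) Df.
have [z zy ->] := MVT yl f' cf.
rewrite mulfK ?gt_eqF ?subr_gt0//; move: zy; rewrite in_itv/= => /andP[z0 zy].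
apply: hd => //; rewrite /ball/= gtr0_norm ?subr_gt0//; lra.
Qed.

Lemma D1on_ext a b f f' g : (forall y : R, y \in `[a, b] -> f y = f' y) ->
  D1on a b f g -> D1on a b f' g.
Proof.
move=> ff' [cf Df]; split.
  apply: subspace_eq_continuous cf => y; rewrite inE/= => yab.
  exact: ff'.
move=> y yab; apply: near_eq_is_derive (Df y yab).
have := yab; rewrite in_itv/= => yab'.
near=> z; apply: ff'; apply: subset_itv_oo_cc; near: z.
exact: near_in_itvoo.
Unshelve. all: by end_near. Qed.

End EndpointSlopes.

Section Bridge.
Context {R : realType} {n : nat} {I J : finType}.
Variable G : network_data R n I J.
Hypothesis hG : is_network G.
Implicit Types (u : 'rV[R]_n -> R).

Lemma rV_hausdorff : hausdorff_space 'rV[R]_n.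
Proof. exact: norm_hausdorff. Qed.

Lemma epar_cont j : {within `[0, elen G j], continuous (epar G j)}.
Proof. exact: epar_continuous. Qed.

Lemma ecoordK j (y : R) : y \in `[0, elen G j] -> ecoord G j (epar G j y) = y.
Proof.
move=> yj; apply: pinvKV; last by rewrite inE.
by move=> x z; rewrite !inE; exact: epar_inj.
Qed.

(** The inverse of the parametrization is continuous at the points of the
    closed edge: the part of the edge at parameter distance at least [d] from
    [y0] is compact and misses [epar G j y0]. *)
Lemma epar_near j (y0 d : R) : y0 \in `[0, elen G j] -> 0 < d ->
  \forall x \near within (open_edge G j) (nbhs (epar G j y0)),
  exists y : R, [/\ y \in `]0, elen G j[, epar G j y = x & `|y - y0| < d].
Proof.
move=> y0j d0; rewrite near_withinE.
pose K : set R := `[0, elen G j] `&` ~` ball y0 d.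
have cK : compact K.
  apply: compact_closedI; first exact: segment_compact.
  by apply: open_closedC; exact: ball_open.
have cE : closed (epar G j @` K).
  apply: compact_closed; first exact: rV_hausdorff.
  apply: continuous_compact => //.
  have sub : K `<=` `[0, elen G j] by move=> x [].
  exact: (continuous_subspaceW sub (@epar_cont j)).
have nE : ~ (epar G j @` K) (epar G j y0).
  move=> [y [yj yb] e]; apply: yb.
  by rewrite (epar_inj hG yj y0j e); exact: ballxx.
have : nbhs (epar G j y0) (~` (epar G j @` K)).
  by apply: open_nbhs_nbhs; split => //; exact: closed_openC.
apply: filterS => x xE [y yj yx]; exists y; split => //.
apply: contrapT => yd; apply: xE; exists y => //; split.
  exact: subset_itv_oo_cc.
by rewrite /ball/= distrC.
Qed.

(** Hence the filter that defines oriented derivatives is proper. *)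
Lemma closure_open_edge j (y0 : R) : y0 \in `[0, elen G j] ->
  closure (open_edge G j) (epar G j y0).
Proof.
move=> y0j B nB.
have l0 := elen_gt0 hG j.
have /subspace_continuousP/(_ _ y0j) cy := @epar_cont j.
have {cy nB} := cy _ nB.
rewrite nbhs_simpl/= /within/= => /nbhs_ballP[d /= d0 hd].
have [y [yj yd]] : exists y : R, (y \in `]0, elen G j[) /\ `|y0 - y| < d.
  move: y0j; rewrite in_itv/= => /andP[y00 y0l].
  have [y0h|y0h] := leP (elen G j / 2) y0.
  - have m1 : Num.min (d / 2) (elen G j / 4) <= d / 2 by rewrite ge_min lexx.
    have m2 : Num.min (d / 2) (elen G j / 4) <= elen G j / 4.
      by rewrite ge_min lexx orbT.
    have m3 : 0 < Num.min (d / 2) (elen G j / 4) by rewrite lt_min !divr_gt0.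
    exists (y0 - Num.min (d / 2) (elen G j / 4)); rewrite in_itv/=.
    move: m1 m2 m3; set m := Num.min _ _ => m1 m2 m3.
    split; first by apply/andP; split; lra.
    by rewrite opprB addrCA subrr addr0 gtr0_norm//; lra.
  - have m1 : Num.min (d / 2) (elen G j / 4) <= d / 2 by rewrite ge_min lexx.
    have m2 : Num.min (d / 2) (elen G j / 4) <= elen G j / 4.
      by rewrite ge_min lexx orbT.
    have m3 : 0 < Num.min (d / 2) (elen G j / 4) by rewrite lt_min !divr_gt0.
    exists (y0 + Num.min (d / 2) (elen G j / 4)); rewrite in_itv/=.
    move: m1 m2 m3; set m := Num.min _ _ => m1 m2 m3.
    split; first by apply/andP; split; lra.
    by rewrite opprD addNKr normrN gtr0_norm//; lra.
exists (epar G j y); split; first by exists y.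
by apply: hd => //; exact: subset_itv_oo_cc.
Qed.

(** An oriented derivative computed in the edge coordinate. *)
Lemma oriented_derivativeP u j i (y0 L : R) : y0 \in `[0, elen G j] ->
  epar G j y0 = vertex G i ->
  (forall e : R, 0 < e -> exists2 d : R, 0 < d &
    forall y : R, y \in `]0, elen G j[ -> `|y - y0| < d ->
    `|L - (on_edge G u j y - on_edge G u j y0) / `|y - y0| | <= e) ->
  oriented_derivative G u j i = L.
Proof.
move=> y0j ev H; rewrite /oriented_derivative -ev.
have cl : ProperFilter (within (open_edge G j) (nbhs (epar G j y0))).
  by apply: within_nbhs_proper; exact: closure_open_edge.
apply: cvg_lim; first exact: Rhausdorff.
apply/cvgrPdist_le => e e0; have [d d0 hd] := H e e0.
apply: filterS (epar_near y0j d0) => x [y [yj <- yd]].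
by rewrite !ecoordK//; [exact: hd|exact: subset_itv_oo_cc].
Qed.

Lemma oriented_derivative_start u j i (g : R -> R) :
  epar G j 0 = vertex G i -> D1on 0 (elen G j) (on_edge G u j) g ->
  {within `[0, elen G j], continuous g} -> oriented_derivative G u j i = g 0.
Proof.
move=> ev Du cg; have l0 := elen_gt0 hG j.
apply: (@oriented_derivativeP _ _ _ 0) => //.
  by rewrite in_itv/= lexx ltW.
move=> e e0; have [d d0 hd] := slope_at_start l0 Du cg e0.
exists d => // y; rewrite in_itv/= => /andP[y0 yl]; rewrite subr0 gtr0_norm//.
exact: hd.
Qed.

Lemma oriented_derivative_end u j i (g : R -> R) :
  epar G j (elen G j) = vertex G i -> D1on 0 (elen G j) (on_edge G u j) g ->
  {within `[0, elen G j], continuous g} ->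
  oriented_derivative G u j i = - g (elen G j).
Proof.
move=> ev Du cg; have l0 := elen_gt0 hG j.
apply: (@oriented_derivativeP _ _ _ (elen G j)) => //.
  by rewrite in_itv/= lexx ltW.
move=> e e0; have [d d0 hd] := slope_at_end l0 Du cg e0.
exists d => // y; rewrite in_itv/= => /andP[y0 yl].
rewrite distrC gtr0_norm ?subr_gt0// => yd.
have := hd y y0 yl yd; rewrite -normrN; congr (`|_| <= _).
by move: (_ ^-1) => D; ring.
Qed.

Lemma exists_endpoints : exists st : (J -> I) * (J -> I),
  (forall j, epar G j 0 = vertex G (st.1 j)) /\
  (forall j, epar G j (elen G j) = vertex G (st.2 j)).
Proof.
have Hs j : exists i, vertex G i = epar G j 0.
  by have [i _ ei] := epar_start hG j; exists i.
have Ht j : exists i, vertex G i = epar G j (elen G j).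
  by have [i _ ei] := epar_end hG j; exists i.
have [s hs] := choice Hs; have [t ht] := choice Ht.
by exists (s, t); split.
Qed.

Variables (s t : J -> I).
Hypothesis sE : forall j, epar G j 0 = vertex G (s j).
Hypothesis tE : forall j, epar G j (elen G j) = vertex G (t j).

Let in0 j : (0 : R) \in `[0, elen G j].
Proof. by rewrite in_itv/= lexx ltW ?(elen_gt0 hG). Qed.

Let inl j : elen G j \in `[0, elen G j].
Proof. by rewrite in_itv/= lexx ltW ?(elen_gt0 hG). Qed.

(** The injectivity of the parametrizations on closed segments excludes
    loops. *)
Lemma endpoints_neq j : s j != t j.
Proof.
apply/eqP => st; have := elen_gt0 hG j.
have e : epar G j 0 = epar G j (elen G j) by rewrite sE tE st.
by rewrite -(epar_inj hG (in0 j) (inl j) e) ltxx.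
Qed.

Lemma sum_Inc i (F : J -> R) : \sum_(j in Inc G i) F j =
  \sum_(j | s j == i) F j + \sum_(j | t j == i) F j.
Proof.
have IncE j : (j \in Inc G i) = (s j == i) || (t j == i).
  by rewrite inE sE tE !(inj_eq (vertex_inj hG)).
rewrite (eq_bigl _ _ IncE) (bigID (fun j => s j == i))/=; congr (_ + _).
  by apply: eq_bigl => j; case: (s j == i); rewrite ?andbF.
apply: eq_bigl => j; case: (eqVneq (s j) i) => [e|_] /=; last by rewrite andbT.
by have := endpoints_neq j; rewrite e eq_sym => /negbTE ->.
Qed.

Lemma edge_point_cases j (y : R) : y \in `[0, elen G j] ->
  [\/ y = 0, y = elen G j | y \in `]0, elen G j[ ].
Proof.
rewrite !in_itv/= => /andP[y0 yl].
have [->|y0'] := eqVneq y 0; first by constructor 1.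
have [->|yl'] := eqVneq y (elen G j); first by constructor 2.
by constructor 3; rewrite !lt_neqAle eq_sym y0' y0 yl' yl.
Qed.

(** The vertices that satisfy [P], together with the closed edges that start
    from them. *)
Definition subnetwork (P : I -> Prop) : set 'rV[R]_n :=
  (\bigcup_(i in [set i | P i]) [set vertex G i]) `|`
  (\bigcup_(j in [set j | P (s j)]) (epar G j @` `[0, elen G j])).

Lemma closed_subnetwork P : closed (subnetwork P).
Proof.
apply: closedU; apply: closed_bigcup => [|i _]; try exact: finite_finset.
- apply: compact_closed; first exact: rV_hausdorff.
  exact: compact_set1.
- apply: compact_closed; first exact: rV_hausdorff.
  apply: continuous_compact; last exact: segment_compact.
  exact: epar_cont.
Qed.

Lemma network_sub P : network_set G `<=` subnetwork P `|` subnetwork (fun i => ~ P i).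
Proof.
move=> x [[i _ <-]|[j _ [y yj <-]]].
- by have [Pi|Pi] := pselect (P i); [left|right]; left; exists i.
- by have [Pi|Pi] := pselect (P (s j)); [left|right]; right; exists j => //;
    exists y => //; exact: subset_itv_oo_cc.
Qed.

(** When no edge joins [P] to its complement, the two subnetworks are
    disjoint; both are closed and together they cover the network. *)
Lemma subnetwork_disjoint P : (forall j, P (s j) <-> P (t j)) ->
  forall x, subnetwork P x -> ~ subnetwork (fun i => ~ P i) x.
Proof.
move=> Pst.
have notin j i (y : R) : y \in `[0, elen G j] -> epar G j y = vertex G i ->
    s j = i \/ t j = i.
  move=> /edge_point_cases[->|->|yj] e.
  - by left; apply: (vertex_inj hG); rewrite -sE.
  - by right; apply: (vertex_inj hG); rewrite -tE.
  - by have := @vertex_notin_edge _ _ _ _ _ hG i j; case; exists y.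
have notin' j i (y : R) : y \in `[0, elen G j] -> epar G j y = vertex G i ->
    (P (s j) <-> P i).
  by move=> yj e; have [<-//|<-] := notin j i y yj e; exact: Pst.
move=> x [[i Pi ->]|[j Pj [y yj <-]]] [[i' Pi' /= e]|[j' Pj' [y' yj' e]]].
- by apply: Pi'; rewrite -(vertex_inj hG e).
- by apply: Pj'; exact/(notin' _ _ _ yj' e).
- by apply: Pi'; exact/(notin' _ _ _ yj e).
- have [jj|jj] := eqVneq j j'; first by apply: Pj'; rewrite -jj.
  have [y0|yl|yoo] := edge_point_cases yj.
  + by apply: Pj'; apply/(notin' _ (s j) _ yj'); rewrite // e y0 sE.
  + by apply: Pj'; apply/(notin' _ (t j) _ yj'); [rewrite e yl tE|exact/Pst].
  have [y0|yl|yoo'] := edge_point_cases yj'.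
  + by apply: Pj'; apply/(notin' _ (s j') _ yj); rewrite // -e y0 sE.
  + by apply: Pj'; apply/Pst; apply/(notin' _ (t j') _ yj); rewrite // -e yl tE.
  have /seteqP[/(_ (epar G j y)) dis _] := edges_disjoint hG jj.
  by apply: dis; split; [exists y|exists y'].
Qed.

(** Connectedness of the underlying graph: a set of vertices that is nonempty
    and closed under adjacency contains every vertex. *)
Lemma network_graph_connected (P : I -> Prop) : (exists i, P i) ->
  (forall j, P (s j) <-> P (t j)) -> forall i, P i.
Proof.
move=> [i0 Pi0] Pst i; apply: contrapT => nPi.
have net i' : network_set G (vertex G i') by left; exists i'.
have : network_set G `&` subnetwork P = network_set G.
  apply: (network_connected hG).
  - by exists (vertex G i0); split => //; left; exists i0.
  - exists (~` subnetwork (fun i => ~ P i)).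
      by apply: closed_openC; exact: closed_subnetwork.
    apply/seteqP; split=> x [nx Px]; split => //.
      exact: subnetwork_disjoint Px.
    by have [|/Px] := @network_sub P _ nx.
  - by exists (subnetwork P) => //; exact: closed_subnetwork.
move=> /seteqP[_ /(_ _ (net i))[_ h]].
by apply: (subnetwork_disjoint Pst h); left; exists i.
Qed.

End Bridge.

Lemma D1on_derive2 (R : realType) (a b : R) (f g d : R -> R) :
  D1on a b f g -> D1on a b g d ->
  forall y : R, y \in `]a, b[ -> (f^`(2))%classic y = d y.
Proof.
move=> [_ Df] [_ Dg] y yab; rewrite derive1nS derive1n1 derive1E.
have [_ <-] := Dg y yab; apply: near_eq_derive.
have := yab; rewrite in_itv/= => yab'.
near=> z.
have zab : z \in `]a, b[ by near: z; exact: near_in_itvoo.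
by have [_ <-] := Df z zab; rewrite derive1E.
Unshelve. all: by end_near. Qed.

Section Conversion.
Context {R : realType} {n : nat} {I J : finType}.
Variable G : network_data R n I J.
Hypothesis hG : is_network G.
Variables (s t : J -> I).
Hypothesis sE : forall j, epar G j 0 = vertex G (s j).
Hypothesis tE : forall j, epar G j (elen G j) = vertex G (t j).
Variable h : 'rV[R]_n -> R.

Lemma KW_solution_sol c u : KW_solution G h c u -> exists g,
  sol s t (elen G) (on_edge G h) c (fun i => u (vertex G i)) (on_edge G u) g.
Proof.
move=> [[_ C2] eqn _ kir].
have H j : exists g : R -> R, D1on 0 (elen G j) (on_edge G u j) g /\
    D1on 0 (elen G j) g (fun y => c - on_edge G h j y * expR (on_edge G u j y)).
  have [cf [g1 [g2 [cg1 _ d1 d2]]]] := C2 j; exists g1.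
  have D1 : D1on 0 (elen G j) (on_edge G u j) g1 by [].
  have D2 : D1on 0 (elen G j) g1 g2 by [].
  have D12 := D1on_derive2 D1 D2.
  by split => //; apply: D1on_eq D2 => // y yj; rewrite -eqn// D12.
have [g hg] := choice H; exists g; split.
- by move=> j; rewrite /on_edge sE.
- by move=> j; rewrite /on_edge tE.
- by move=> j; have [] := hg j.
- by move=> j; have [] := hg j.
- move=> i; have := kir i; rewrite (sum_Inc hG sE tE).
  rewrite (eq_bigr (fun j => g j 0)); last first.
    move=> j /eqP ji; have [D1 D2] := hg j.
    by apply: (oriented_derivative_start hG _ D1 (D1on_cont D2)); rewrite sE ji.
  rewrite [X in _ + X](eq_bigr (fun j => - g j (elen G j))); last first.
    move=> j /eqP ji; have [D1 D2] := hg j.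
    by apply: (oriented_derivative_end hG _ D1 (D1on_cont D2)); rewrite tE ji.
  by rewrite sumrN => /subr0_eq.
Qed.

(** Edge functions that agree at the vertices define a function on the
    ambient space. *)
Lemma network_function_extension (a : I -> R) (U : J -> R -> R) :
  (forall j, U j 0 = a (s j)) -> (forall j, U j (elen G j) = a (t j)) ->
  exists u : 'rV[R]_n -> R,
    forall j (y : R), y \in `[0, elen G j] -> on_edge G u j y = U j y.
Proof.
move=> U0 Ul.
have H x : exists r : R, forall j (y : R), y \in `[0, elen G j] ->
    epar G j y = x -> r = U j y.
  (* A point of the network is a vertex or lies in exactly one open edge.
Other points get the value [0]. *)
  have [[i ->]|nv] := pselect (exists i, x = vertex G i).
    exists (a i) => j y /edge_point_cases[->|->|yj].
    - by rewrite sE U0 => /(vertex_inj hG) ->.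
    - by rewrite tE Ul => /(vertex_inj hG) ->.
    - by move=> e; have := @vertex_notin_edge _ _ _ _ _ hG i j; case; exists y.
  have [[j [y [yj ex]]]|ne] := pselect (exists j (y : R),
      (y \in `[0, elen G j]) /\ epar G j y = x); last first.
    by exists 0 => j y yj e; exfalso; apply: ne; exists j, y.
  have inner k (z : R) : z \in `[0, elen G k] -> epar G k z = x ->
      z \in `]0, elen G k[.
    move=> /edge_point_cases[->|->|//] e; exfalso; apply: nv.
    - by exists (s k); rewrite -sE.
    - by exists (t k); rewrite -tE.
  exists (U j y) => k z zk ez.
  have [jk|jk] := eqVneq j k.
    subst k; congr (U j _); apply: (epar_inj hG yj zk); by rewrite ex.
  have /seteqP[/(_ x) dis _] := edges_disjoint hG jk.
  case: dis; split; [exists y|exists z] => //; exact: inner.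
have [u hu] := choice H.
by exists u => j y yj; exact: (hu _ j y yj).
Qed.

Lemma sol_KW_solution c a U g : network_continuous G h ->
  sol s t (elen G) (on_edge G h) c a U g -> exists u, KW_solution G h c u.
Proof.
move=> [ch _] [U0 Ul DU Dg K].
have [u hu] := network_function_extension U0 Ul.
have Du j : D1on 0 (elen G j) (on_edge G u j) (g j).
  by apply: D1on_ext (DU j) => y yj; rewrite hu.
have Dg' j : D1on 0 (elen G j) (g j)
    (fun y => c - on_edge G h j y * expR (on_edge G u j y)).
  apply: D1on_eq (Dg j) => // y yj; rewrite hu//; exact: subset_itv_oo_cc.
have match_u : vertex_matching G u.
  have atv i j : j \in Inc G i ->
      on_edge G u j (ecoord G j (vertex G i)) = u (vertex G i).
    rewrite inE => /orP[/eqP <-|/eqP <-]; rewrite (ecoordK hG) //.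
    - by rewrite in_itv/= lexx ltW// (elen_gt0 hG).
    - by rewrite in_itv/= lexx ltW// (elen_gt0 hG).
  by move=> i j k ij ik; rewrite !atv.
exists u; split => //.
- split; first by split => // j; exact: D1on_cont (Du j).
  move=> j; split; first exact: D1on_cont (Du j).
  exists (g j), (fun y => c - on_edge G h j y * expR (on_edge G u j y)); split.
  + exact: D1on_cont (Dg' j).
  + apply: within_continuousD; first exact: within_continuous_cst.
    apply: within_continuousN; apply: within_continuousM; first exact: ch.
    exact: within_continuous_expR (D1on_cont (Du j)).
  + by have [] := Du j.
  + by have [] := Dg' j.
- by move=> j y yj; rewrite (D1on_derive2 (Du j) (Dg' j)).
- move=> i; rewrite (sum_Inc hG sE tE).
  rewrite (eq_bigr (fun j => g j 0)); last first.
    move=> j /eqP ji; have cg := D1on_cont (Dg j).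
    by apply: (oriented_derivative_start hG _ (Du j) cg); rewrite sE ji.
  rewrite [X in _ + X](eq_bigr (fun j => - g j (elen G j))); last first.
    move=> j /eqP ji; have cg := D1on_cont (Dg j).
    by apply: (oriented_derivative_end hG _ (Du j) cg); rewrite tE ji.
  by rewrite sumrN K subrr.
Qed.

End Conversion.

Unset Implicit Arguments.
Set Strict Implicit.

Theorem proposition5p1 (R : realType) (n : nat) (I J : finType)
    (G : network_data R n I J) (hG : is_network G)
    (h : 'rV[R]_n -> R) (h_cont : network_continuous G h)
    (h_int : network_integral G h < 0)
    (ch : \bar R) (h_ch : is_critical_constant G h ch)
    (ch_fin : (-oo < ch)%E) :
  exists u : 'rV[R]_n -> R, KW_solution G h (fine ch) u.
Proof.
have [ch0 above _] := h_ch.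
case: ch h_ch ch_fin ch0 above => [c| |] //= _ _; rewrite lte_fin => c0 above.
have [[s t] /= [sE tE]] := exists_endpoints hG.
have l0 := elen_gt0 hG.
have [chj _] := h_cont.
pose H j (y : R) := \int[@lebesgue_measure R]_(r in `[0, y]) on_edge G h j r.
have DH j : D1on 0 (elen G j) (H j) (on_edge G h j).
  by apply: int_D1on; [exact: ltW|exact: chj].
have H0 : \sum_j (H j (elen G j) - H j 0) < 0.
  rewrite (eq_bigr (fun j => H j (elen G j))); first exact: h_int.
  by move=> j _; rewrite /H set_itv1 /Rintegral integral_set1 subr0.
have conn := network_graph_connected hG sE tE.
have Nc0 : 0 < - c by rewrite oppr_gt0.
have ex c' : - - c < c' -> c' < 0 ->
    exists a U g, sol s t (elen G) (on_edge G h) c' a U g.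
  rewrite opprK => cc' c'0; have cc'E : (c%:E < c'%:E)%E by rewrite lte_fin.
  have [u /(KW_solution_sol hG sE tE)[g S]] := above c' cc'E c'0.
  by eexists; eexists; exists g; exact: S.
have [a [U [g S]]] := critical_solution l0 (edges_nonempty hG) conn chj Nc0 DH H0 ex.
by rewrite opprK in S; exact: (sol_KW_solution hG sE tE h_cont S).
Qed.
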